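(* Let $(R,\Lambda)$ be a Noetherian algebra. Then there is an isomorphism of posets $$\mathsf{serre}\,\Lambda\simeq\mathsf{P}_{\rm down}(\mathsf{Sim}_R\Lambda),\qquad \mathcal{C}\mapsto\bigsqcup_{\mathfrak p\in\operatorname{Spec}R}(\mathcal{C}_{\mathfrak p}\cap\mathsf{sim}\,\Lambda_{\mathfrak p}).$$
   Context: A Noetherian algebra $(R,\Lambda)$ is a commutative Noetherian ring $R$ with a (not necessarily commutative) $R$-algebra $\Lambda$ that is finitely generated as an $R$-module. $\mathsf{mod}\,\Lambda$ is the category of finitely generated left $\Lambda$-modules. $\mathsf{serre}\,\Lambda$ is the set of Serre subcategories of $\mathsf{mod}\,\Lambda$ (full, closed under isomorphisms, containing $0$, closed under subobjects, factor objects and extensions), ordered by inclusion. For $\mathfrak p\in\operatorname{Spec}R$, $\Lambda_{\mathfrak p}:=R_{\mathfrak p}\otimes_R\Lambda$; for a subcategory $\mathcal C$ of $\mathsf{mod}\,\Lambda$, $\mathcal C_{\mathfrak p}:=\{X_{\mathfrak p}\mid X\in\mathcal C\}\subseteq\mathsf{mod}\,\Lambda_{\mathfrak p}$ (up to isomorphism). $\mathsf{sim}\,\Lambda_{\mathfrak p}$ is the set of isomorphism classes of simple $\Lambda_{\mathfrak p}$-modules, and $\mathsf{Sim}_R\Lambda:=\bigsqcup_{\mathfrak p\in\operatorname{Spec}R}\mathsf{sim}\,\Lambda_{\mathfrak p}$ is a poset as follows: for $S\in\mathsf{sim}\,\Lambda_{\mathfrak p}$ and $T\in\mathsf{sim}\,\Lambda_{\mathfrak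 q}$, $S\le T$ if and only if $\mathfrak p\supseteq\mathfrak q$ and $S$ is a subfactor of $T$ as a $\Lambda_{\mathfrak p}$-module, where $T$ is a $\Lambda_{\mathfrak p}$-module via $\Lambda_{\mathfrak p}\to\Lambda_{\mathfrak q}$. A down-set of a poset $X$ is a subset $Y$ such that $a\le b$ and $b\in Y$ imply $a\in Y$; $\mathsf P_{\rm down}(X)$ is the set of down-sets of $X$ ordered by inclusion. *)

(* Defs.v *)
From HB Require Import structures.
From mathcomp Require Import all_boot all_algebra.
From mathcomp Require Import boolp ring.

Set Implicit Arguments.
Unset Strict Implicit.
Unset Printing Implicit Defensive.

Import GRing.Theory.
Local Open Scope ring_scope.
Local Open Scope quotient_scope.

Section Modules.
Variable A : pzRingType.

Definition surjective (X Y : Type) (f : X -> Y) := forall y, exists x, f x = y.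

Definition isomorphic (M N : lmodType A) : Prop :=
  exists f : {linear M -> N}, bijective f.

Definition fg_submod (M : lmodType A) (U : {pred M}) : Prop :=
  exists (n : nat) (g : 'I_n -> M),
    (forall i, g i \in U) /\
    (forall x, x \in U -> exists c : 'I_n -> A, x = \sum_i c i *: g i).

Definition finitely_generated (M : lmodType A) : Prop := @fg_submod M predT.

Definition simple_module (M : lmodType A) : Prop :=
  (exists x : M, x != 0) /\
  (forall U : {pred M}, GRing.submod_closed U ->
     (forall x, x \in U -> x = 0) \/ (forall x, x \in U)).

(* S is a quotient of a submodule U of T. *)
Definition subfactor (S T : lmodType A) : Prop :=
  exists (U : lmodType A) (i : {linear U -> T}) (q : {linear U -> S}),
    injective i /\ surjective q.

(* Serre subcategories of the category of finitely generated A-modules, as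
   predicates on A-modules.  The choiceType structure that lmodType demands
   is no restriction: boolp puts one on every type. *)
Record is_serre (C : lmodType A -> Prop) : Prop := {
  serre_fg : forall X, C X -> finitely_generated X;
  serre_iso : forall X Y, isomorphic X Y -> C X -> C Y;
  serre_zero : forall X : lmodType A, (forall x : X, x = 0) -> C X;
  serre_sub : forall (X Y : lmodType A) (f : {linear X -> Y}),
    finitely_generated X -> injective f -> C Y -> C X;
  serre_quot : forall (X Y : lmodType A) (f : {linear X -> Y}),
    finitely_generated Y -> surjective f -> C X -> C Y;
  serre_ext : forall (X Y Z : lmodType A)
      (f : {linear X -> Y}) (g : {linear Y -> Z}),
    finitely_generated Y -> injective f -> surjective g ->
    (forall y, g y = 0 <-> exists x, f x = y) -> C X -> C Z -> C Y
}.

Record serre := Serre {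
  serre_mem :> lmodType A -> Prop;
  serreP : is_serre serre_mem
}.

Definition serre_le (C D : serre) : Prop := forall X, C X -> D X.

(* An isomorphism class of simple modules is the predicate of its members. *)
Record sim := Sim {
  sim_mem :> lmodType A -> Prop;
  simP : exists2 S, simple_module S & forall T, sim_mem T <-> isomorphic S T
}.

End Modules.

Lemma serre_ext_eq (A : pzRingType) (C D : serre A) : (forall X, C X <-> D X) -> C = D.
Proof.
case: C => C hC; case: D => D hD /= h.
have e : C = D by apply: funext => X; apply: propext.
by subst D; congr Serre; apply: Prop_irrelevance.
Qed.

Lemma iso_trans (A : pzRingType) (M N P : lmodType A) :
  isomorphic M N -> isomorphic N P -> isomorphic M P.
Proof. by move=> [f bf] [g bg]; exists (g \o f); exact: bij_comp. Qed.

Lemma iso_sym (A : pzRingType) (M N : lmodType A) : isomorphic M N -> isomorphic N M.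
Proof.
move=> [f [g fK gK]].
have lg : linear g by move=> a u v; apply: (can_inj fK); rewrite linearP !gK.
pose G := GRing.isLinear.Build _ _ _ _ g lg.
pose g' : {linear N -> M} := HB.pack g G.
by exists g'; exists f.
Qed.

Lemma sim_eqP (A : pzRingType) (c d : sim A) S : c S -> d S -> c = d.
Proof.
case: c d => [c [S1 h1 c1]] [d [S2 h2 d2]] /= cS dS.
have e : c = d.
  apply: funext => X; apply: propext; split.
    move/c1 => h; apply/d2; apply: (iso_trans _ h).
    by apply: (@iso_trans _ _ S); [exact/d2|apply: iso_sym; exact/c1].
  move/d2 => h; apply/c1; apply: (iso_trans _ h).
  by apply: (@iso_trans _ _ S); [exact/c1|apply: iso_sym; exact/d2].
by subst d; congr Sim; apply: Prop_irrelevance.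
Qed.

Definition restrict (A B : pzRingType) (f : {rmorphism A -> B})
  (M : lmodType B) : Type := M.

Section Restrict.
Variables (A B : pzRingType) (f : {rmorphism A -> B}) (M : lmodType B).

HB.instance Definition _ := GRing.Zmodule.on (restrict f M).

Definition restrict_scale (a : A) (m : restrict f M) : restrict f M :=
  f a *: (m : M).

Fact restrict_scaleA a b m :
  restrict_scale a (restrict_scale b m) = restrict_scale (a * b) m.
Proof. by rewrite /restrict_scale rmorphM scalerA. Qed.

Fact restrict_scale1 : left_id 1 restrict_scale.
Proof. by move=> m; rewrite /restrict_scale rmorph1 scale1r. Qed.

Fact restrict_scaleDr : right_distributive restrict_scale +%R.
Proof. by move=> a m n; rewrite /restrict_scale scalerDr. Qed.

Fact restrict_scaleDl m : {morph restrict_scale^~ m : a b / a + b}.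
Proof. by move=> a b; rewrite /restrict_scale rmorphD scalerDl. Qed.

HB.instance Definition _ := GRing.Zmodule_isLmodule.Build A (restrict f M)
  restrict_scaleA restrict_scale1 restrict_scaleDr restrict_scaleDl.

Lemma restrict_scaleE a (m : restrict f M) : a *: m = f a *: (m : M).
Proof. by []. Qed.

End Restrict.

Definition noetherian (R : comPzRingType) : Prop :=
  forall I : {pred R^o}, GRing.submod_closed I -> fg_submod I.

Record spec (R : comPzRingType) := Spec {
  spec_set :> pred R;
  spec_ideal : GRing.submod_closed (spec_set : {pred R^o});
  spec_proper : 1 \notin spec_set;
  spec_prime : forall x y,
    x * y \in spec_set -> (x \in spec_set) || (y \in spec_set)
}.

Definition den (R : comPzRingType) (p : spec R) : Type :=
  {s : R | s \notin spec_set p}.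

Section Den.
Variables (R : comPzRingType) (p : spec R).

HB.instance Definition _ := Choice.on (den p).

Fact den_mul_subproof (s t : den p) : sval s * sval t \notin spec_set p.
Proof.
apply/negP => /spec_prime /orP[]; apply/negP; [exact: (svalP s)|exact: (svalP t)].
Qed.

Definition den1 : den p := exist _ (1 : R) (spec_proper p).
Definition den_mul (s t : den p) : den p :=
  exist _ (sval s * sval t) (den_mul_subproof s t).

Lemma sval_den1 : sval den1 = 1. Proof. by []. Qed.
Lemma sval_den_mul s t : sval (den_mul s t) = sval s * sval t. Proof. by []. Qed.

End Den.

Section Localization.
Variables (R : comPzRingType) (p : spec R) (M : lmodType R).

Definition frac_equiv (x y : M * den p) : bool :=
  `[< exists u : den p,
        sval u *: (sval y.2 *: x.1) = sval u *: (sval x.2 *: y.1) >].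

Fact frac_equiv_refl : reflexive frac_equiv.
Proof. by move=> x; apply/asboolP; exists (den1 p). Qed.

Fact frac_equiv_sym : symmetric frac_equiv.
Proof. by move=> x y; apply/asboolP/asboolP => -[u e]; exists u. Qed.

Fact frac_equiv_trans : transitive frac_equiv.
Proof.
move=> [n t] [m s] [k r] /asboolP[u /= e1] /asboolP[v /= e2].
apply/asboolP; exists (den_mul (den_mul u v) t) => /=.
rewrite !scalerA in e1 e2 *.
transitivity ((sval v * sval r) *: ((sval u * sval t) *: m)).
  by rewrite scalerA; congr (_ *: _); ring.
rewrite e1 scalerA.
transitivity ((sval u * sval s) *: ((sval v * sval r) *: n)).
  by rewrite scalerA; congr (_ *: _); ring.
by rewrite e2 scalerA; congr (_ *: _); ring.
Qed.

Canonical frac_equiv_rel :=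
  EquivRel frac_equiv frac_equiv_refl frac_equiv_sym frac_equiv_trans.

Definition loc : Type := {eq_quot frac_equiv}.

HB.instance Definition _ : EqQuotient _ frac_equiv loc := EqQuotient.on loc.
HB.instance Definition _ := Choice.on loc.

Definition frac (m : M) (s : den p) : loc := \pi_loc (m, s).

Lemma fracP m s n t :
  frac m s = frac n t <->
  exists u : den p, sval u *: (sval t *: m) = sval u *: (sval s *: n).
Proof.
rewrite /frac; split.
  by move=> /eqmodP /asboolP.
by move=> h; apply/eqmodP/asboolP.
Qed.

Lemma fracW (P : loc -> Prop) : (forall m s, P (frac m s)) -> forall x, P x.
Proof. by move=> h; elim/quotW => -[m s]; apply: h. Qed.

Lemma frac_repr m s : exists u : den p,
  (sval u * sval s) *: (repr (frac m s)).1 =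
  (sval u * sval (repr (frac m s)).2) *: m.
Proof.
have : frac (repr (frac m s)).1 (repr (frac m s)).2 = frac m s.
  by rewrite /frac -surjective_pairing reprK.
by move=> /fracP[u]; rewrite !scalerA => e; exists u.
Qed.

Lemma frac_eq m s n t :
  sval t *: m = sval s *: n -> frac m s = frac n t.
Proof. by move=> e; apply/fracP; exists (den1 p); rewrite e. Qed.

Definition loc_add (x y : loc) : loc :=
  let: (m, s) := repr x in let: (n, t) := repr y in
  frac (sval t *: m + sval s *: n) (den_mul s t).

Definition loc_opp (x : loc) : loc := let: (m, s) := repr x in frac (- m) s.

Definition loc_scale (r : R) (x : loc) : loc :=
  let: (m, s) := repr x in frac (r *: m) s.

Lemma loc_addE m s n t :
  loc_add (frac m s) (frac n t) =
  frac (sval t *: m + sval s *: n) (den_mul s t).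
Proof.
rewrite /loc_add; have [u] := frac_repr m s; have [v] := frac_repr n t.
case: (repr (frac m s)) => m' s' /=; case: (repr (frac n t)) => n' t' /= e2 e1.
apply/fracP; exists (den_mul u v) => /=; rewrite !scalerDr !scalerA.
congr (_ + _).
  transitivity ((sval v * sval t * sval t') *: ((sval u * sval s) *: m')).
    by rewrite scalerA; congr (_ *: _); ring.
  by rewrite e1 scalerA; congr (_ *: _); ring.
transitivity ((sval u * sval s * sval s') *: ((sval v * sval t) *: n')).
  by rewrite scalerA; congr (_ *: _); ring.
by rewrite e2 scalerA; congr (_ *: _); ring.
Qed.

Lemma loc_oppE m s : loc_opp (frac m s) = frac (- m) s.
Proof.
rewrite /loc_opp; have [u] := frac_repr m s.
case: (repr (frac m s)) => m' s' /= e.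
by apply/fracP; exists u; rewrite !scalerN !scalerA e.
Qed.

Lemma loc_scaleE r m s : loc_scale r (frac m s) = frac (r *: m) s.
Proof.
rewrite /loc_scale; have [u] := frac_repr m s.
case: (repr (frac m s)) => m' s' /= e.
apply/fracP; exists u; rewrite !scalerA.
transitivity (r *: ((sval u * sval s) *: m')).
  by rewrite scalerA; congr (_ *: _); ring.
by rewrite e scalerA; congr (_ *: _); ring.
Qed.

Fact loc_addA : associative loc_add.
Proof.
elim/fracW=> m s; elim/fracW=> n t; elim/fracW=> k r; rewrite !loc_addE.
apply: frac_eq => /=; rewrite !scalerDr !scalerA addrA.
by congr (_ *: _ + _ *: _ + _ *: _); ring.
Qed.

Fact loc_addC : commutative loc_add.
Proof.
elim/fracW=> m s; elim/fracW=> n t; rewrite !loc_addE.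
apply: frac_eq => /=; rewrite !scalerDr !scalerA addrC.
by congr (_ *: _ + _ *: _); ring.
Qed.

Fact loc_add0 : left_id (frac 0 (den1 p)) loc_add.
Proof.
elim/fracW=> m s; rewrite loc_addE; apply: frac_eq => /=.
by rewrite scaler0 add0r scale1r mul1r.
Qed.

Fact loc_addN : left_inverse (frac 0 (den1 p)) loc_opp loc_add.
Proof.
elim/fracW=> m s; rewrite loc_oppE loc_addE; apply: frac_eq => /=.
by rewrite scalerN addNr !scaler0.
Qed.

HB.instance Definition _ :=
  GRing.isZmodule.Build loc loc_addA loc_addC loc_add0 loc_addN.

Lemma frac0 : frac 0 (den1 p) = 0. Proof. by []. Qed.

Lemma fracD m s n t :
  frac m s + frac n t = frac (sval t *: m + sval s *: n) (den_mul s t).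
Proof. exact: loc_addE. Qed.

Lemma fracN m s : - frac m s = frac (- m) s.
Proof. exact: loc_oppE. Qed.

Lemma fracDn m n s : frac (m + n) s = frac m s + frac n s.
Proof.
rewrite fracD; apply: frac_eq => /=; rewrite !scalerDr !scalerA.
by congr (_ *: _ + _ *: _).
Qed.

Fact loc_scaleA a b x : loc_scale a (loc_scale b x) = loc_scale (a * b) x.
Proof. by elim/fracW: x => m s; rewrite !loc_scaleE scalerA. Qed.

Fact loc_scale1 : left_id 1 loc_scale.
Proof. by elim/fracW=> m s; rewrite loc_scaleE scale1r. Qed.

Fact loc_scaleDr : right_distributive loc_scale +%R.
Proof.
move=> a; elim/fracW=> m s; elim/fracW=> n t; rewrite fracD !loc_scaleE fracD.
rewrite scalerDr !scalerA; congr (frac (_ *: _ + _ *: _) _); ring.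
Qed.

Fact loc_scaleDl x : {morph loc_scale^~ x : a b / a + b}.
Proof.
by move=> a b; elim/fracW: x => m s; rewrite !loc_scaleE scalerDl fracDn.
Qed.

HB.instance Definition _ := GRing.Zmodule_isLmodule.Build R loc
  loc_scaleA loc_scale1 loc_scaleDr loc_scaleDl.

Lemma fracZ r m s : r *: frac m s = frac (r *: m) s.
Proof. exact: loc_scaleE. Qed.

End Localization.

(* A ring L with a central structure map R -> L.  This is algType R, except
   that algType R excludes the zero ring. *)
Record algebra (R : comPzRingType) := Algebra {
  alg_ring :> pzRingType;
  alg_map : {rmorphism R -> alg_ring};
  alg_central : forall r a, alg_map r * a = a * alg_map r
}.

Definition noetherian_algebra (R : comPzRingType) (L : algebra R) : Prop :=
  noetherian R /\ finitely_generated (restrict (alg_map L) L^o : lmodType R).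

(* The ring L_p and, for an L-module X, the L_p-module X_p, as fractions with
   denominators in R \ p; loc_tens_universal and loc_tensM below identify them
   with R_p (x)_R L and R_p (x)_R X. *)
Definition loc_ring (R : comPzRingType) (p : spec R) (L : algebra R) : Type :=
  loc p (restrict (alg_map L) L^o).

Definition loc_mod (R : comPzRingType) (p : spec R) (L : algebra R)
  (X : lmodType L) : Type := loc p (restrict (alg_map L) X).

Section LocAlgebra.
Variables (R : comPzRingType) (p : spec R) (L : algebra R).

HB.instance Definition _ := GRing.Zmodule.on (loc_ring p L).

Definition rfrac (a : L) (s : den p) : loc_ring p L :=
  @frac R p (restrict (alg_map L) L^o) a s.

Section Act.
Variable X : lmodType L.

HB.instance Definition _ := GRing.Zmodule.on (loc_mod p X).

Definition mfrac (x : X) (s : den p) : loc_mod p X :=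
  @frac R p (restrict (alg_map L) X) x s.

Definition loc_act (a : loc_ring p L) (x : loc_mod p X) : loc_mod p X :=
  let: (b, s) := repr a in let: (y, t) := repr x in
  mfrac ((b : L) *: (y : X)) (den_mul s t).

Lemma loc_actE a s x t :
  loc_act (rfrac a s) (mfrac x t) = mfrac (a *: x) (den_mul s t).
Proof.
rewrite /loc_act /rfrac /mfrac.
have [u] := @frac_repr R p (restrict (alg_map L) L^o) a s.
have [v] := @frac_repr R p (restrict (alg_map L) X) x t.
case: (repr (frac _ s)) => a' s' /=; case: (repr (frac _ t)) => x' t' /= e2 e1.
apply/fracP; exists (den_mul u v) => /=; rewrite !scalerA.
have act r r' (b : L) (y : X) :
    alg_map L (r * r') *: (b *: y) = (alg_map L r * b) *: (alg_map L r' *: y).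
  rewrite !scalerA rmorphM; congr (_ *: _).
  by rewrite -!mulrA (alg_central r' b).
have {}e1 : alg_map L (sval u * sval s) * (a' : L) =
            alg_map L (sval u * sval s') * a := e1.
have {}e2 : alg_map L (sval v * sval t) *: (x' : X) =
            alg_map L (sval v * sval t') *: x := e2.
rewrite !restrict_scaleE.
rewrite (_ : _ * _ = (sval u * sval s) * (sval v * sval t)); last by ring.
by rewrite act e1 e2 -act; congr (alg_map L _ *: _); ring.
Qed.

Lemma mfracP x s y t :
  mfrac x s = mfrac y t <-> exists u : den p,
    alg_map L (sval u * sval t) *: x = alg_map L (sval u * sval s) *: y.
Proof.
have h := @fracP R p (restrict (alg_map L) X) x s y t.
split=> [/(proj1 h)[u e]|[u e]].
  by exists u; rewrite !scalerA in e.
by apply: (proj2 h); exists u; rewrite !scalerA.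
Qed.

Lemma mfracW (P : loc_mod p X -> Prop) :
  (forall x s, P (mfrac x s)) -> forall y, P y.
Proof. exact: (@fracW R p (restrict (alg_map L) X)). Qed.

Lemma mfrac_eq x s y t :
  alg_map L (sval t) *: x = alg_map L (sval s) *: y -> mfrac x s = mfrac y t.
Proof. exact: (@frac_eq R p (restrict (alg_map L) X)). Qed.

Lemma mfracD x s y t :
  mfrac x s + mfrac y t =
  mfrac (alg_map L (sval t) *: x + alg_map L (sval s) *: y) (den_mul s t).
Proof. exact: (@fracD R p (restrict (alg_map L) X)). Qed.

Lemma mfracDn x y s : mfrac (x + y) s = mfrac x s + mfrac y s.
Proof. exact: (@fracDn R p (restrict (alg_map L) X)). Qed.

Fact loc_actDr : right_distributive loc_act +%R.
Proof.
elim/fracW=> a r; elim/mfracW=> x s; elim/mfracW=> y t.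
rewrite -/(rfrac a r) mfracD !loc_actE mfracD scalerDr !scalerA -!alg_central.
apply: mfrac_eq; rewrite !scalerDr !scalerA !mulrA -!rmorphM /=.
by congr (_ * _ *: _ + _ * _ *: _); congr (alg_map L _); ring.
Qed.

Fact loc_actDl x : {morph loc_act^~ x : a b / a + b}.
Proof.
elim/fracW=> a r; elim/fracW=> b s; elim/mfracW: x => x t.
rewrite -/(rfrac a r) -/(rfrac b s) !loc_actE mfracD.
have -> : rfrac a r + rfrac b s =
    rfrac (alg_map L (sval s) * a + alg_map L (sval r) * b) (den_mul r s).
  exact: (@fracD R p (restrict (alg_map L) L^o)).
rewrite loc_actE scalerDl !scalerA.
apply: mfrac_eq; rewrite !scalerDr !scalerA !mulrA -!rmorphM /=.
by congr (_ * _ *: _ + _ * _ *: _); congr (alg_map L _); ring.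
Qed.

Fact loc_act1 : left_id (rfrac 1 (den1 p)) loc_act.
Proof.
elim/mfracW=> x s; rewrite loc_actE scale1r.
by apply: mfrac_eq; rewrite /= mul1r.
Qed.

End Act.

Definition loc_mul (a b : loc_ring p L) : loc_ring p L :=
  @loc_act L^o a b.

Lemma loc_mulE a s b t :
  loc_mul (rfrac a s) (rfrac b t) = rfrac (a * b) (den_mul s t).
Proof. exact: (@loc_actE L^o). Qed.

Fact loc_actA (X : lmodType L) a b (x : loc_mod p X) :
  loc_act a (loc_act b x) = loc_act (loc_mul a b) x.
Proof.
elim/fracW: a => a r; elim/fracW: b => b s; elim/mfracW: x => x t.
rewrite -/(rfrac a r) -/(rfrac b s) loc_mulE !loc_actE scalerA.
by apply: mfrac_eq; rewrite /= mulrA.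
Qed.

Fact loc_mulA : associative loc_mul.
Proof. by move=> a b c; apply: (@loc_actA L^o). Qed.

Fact loc_mul1r : left_id (rfrac 1 (den1 p)) loc_mul.
Proof. exact: (@loc_act1 L^o). Qed.

Fact loc_mulr1 : right_id (rfrac 1 (den1 p)) loc_mul.
Proof.
elim/fracW=> a r; rewrite -/(rfrac a r) loc_mulE mulr1.
by apply: frac_eq; rewrite /= mulr1.
Qed.

Fact loc_mulDl : left_distributive loc_mul +%R.
Proof. by move=> a b c; apply: (@loc_actDl L^o). Qed.

Fact loc_mulDr : right_distributive loc_mul +%R.
Proof. exact: (@loc_actDr L^o). Qed.

HB.instance Definition _ := GRing.Zmodule_isPzRing.Build (loc_ring p L)
  loc_mulA loc_mul1r loc_mulr1 loc_mulDl loc_mulDr.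

HB.instance Definition _ (X : lmodType L) :=
  GRing.Zmodule_isLmodule.Build (loc_ring p L) (loc_mod p X)
    (@loc_actA X) (@loc_act1 X) (@loc_actDr X) (@loc_actDl X).

Lemma rfracW (P : loc_ring p L -> Prop) :
  (forall a s, P (rfrac a s)) -> forall x, P x.
Proof. exact: (@fracW R p (restrict (alg_map L) L^o)). Qed.

Lemma rfracP a s b t :
  rfrac a s = rfrac b t <-> exists u : den p,
    alg_map L (sval u * sval t) * a = alg_map L (sval u * sval s) * b.
Proof. exact: (@mfracP L^o). Qed.

Lemma rfracD a s b t :
  rfrac a s + rfrac b t =
  rfrac (alg_map L (sval t) * a + alg_map L (sval s) * b) (den_mul s t).
Proof. exact: (@fracD R p (restrict (alg_map L) L^o)). Qed.

Lemma rfrac1 : rfrac 1 (den1 p) = 1. Proof. by []. Qed.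

Lemma rfracM a s b t : rfrac a s * rfrac b t = rfrac (a * b) (den_mul s t).
Proof. exact: loc_mulE. Qed.

Lemma mfracZ (X : lmodType L) a s (x : X) t :
  rfrac a s *: mfrac x t = mfrac (a *: x) (den_mul s t).
Proof. exact: loc_actE. Qed.

End LocAlgebra.

Definition balanced (R : comPzRingType) (M N : lmodType R) (V : zmodType)
    (f : M -> N -> V) : Prop :=
  [/\ forall x x' y, f (x + x') y = f x y + f x' y,
      forall x y y', f x (y + y') = f x y + f x y' &
      forall r x y, f (r *: x) y = f x (r *: y)].

Section Tensor.
Variables (R : comPzRingType) (p : spec R) (M : lmodType R).

Definition loc_tens (x : loc p R^o) (m : M) : loc p M :=
  let: (r, s) := repr x in frac ((r : R) *: m) s.

Lemma loc_tensE (r : R^o) s m : loc_tens (frac r s) m = frac ((r : R) *: m) s.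
Proof.
rewrite /loc_tens; have [u] := frac_repr r s.
case: (repr (frac r s)) => r' s' /= e.
have {}e : sval u * sval s * (r' : R) = sval u * sval s' * r := e.
by apply/fracP; exists u; rewrite !scalerA e.
Qed.

Lemma loc_tens_balanced : balanced loc_tens.
Proof.
split.
- elim/fracW=> r s; elim/fracW=> r' s' m; rewrite fracD !loc_tensE fracD.
  by rewrite scalerDl !scalerA.
- by elim/fracW=> r s m m'; rewrite !loc_tensE scalerDr fracDn.
- move=> r; elim/fracW=> x s m; rewrite fracZ !loc_tensE scalerA.
  by congr (frac (_ *: m) s); rewrite mulrC.
Qed.

(* (loc p M, loc_tens) is the tensor product of R_p and M over R. *)
Lemma loc_tens_universal (V : zmodType) (f : loc p R^o -> M -> V) :
  balanced f ->
  exists2 g : {additive loc p M -> V}, (forall x m, g (loc_tens x m) = f x m) &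
    forall h : {additive loc p M -> V},
      (forall x m, h (loc_tens x m) = f x m) -> h =1 g.
Proof.
case=> fDl fDr fZ.
pose one s : loc p R^o := frac (1 : R^o) s.
have fE r s m : f (frac (r : R^o) s) m = f (one s) (r *: m).
  by rewrite -fZ fracZ; congr (f (frac _ s) m); rewrite /GRing.scale /= mulr1.
have fM s t m : f (one s) m = f (one (den_mul s t)) (sval t *: m).
  rewrite -fE; congr (f _ m); apply: frac_eq.
  by rewrite /GRing.scale /= mulr1.
pose g (x : loc p M) : V := f (one (repr x).2) (repr x).1.
have gE m s : g (frac m s) = f (one s) m.
  rewrite /g; have [u] := frac_repr m s.
  case: (repr (frac m s)) => m' s' /= e.
  have eq3 : den_mul s' (den_mul u s) = den_mul s (den_mul u s').
    by apply: val_inj => /=; ring.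
  by rewrite (fM s' (den_mul u s)) (fM s (den_mul u s')) eq3 /= e.
have gD : zmod_morphism g.
  elim/fracW=> m s; elim/fracW=> n t; rewrite fracN fracD !gE fDr.
  have fN x y : f x (- y) = - f x y.
    have f0 : f x 0 = 0 by apply: (addIr (f x 0)); rewrite -fDr !add0r.
    by apply: (addrI (f x y)); rewrite -fDr !addrN.
  rewrite -fM scalerN fN (fM t s); congr (_ - f (one _) _).
  by apply: val_inj; rewrite /= mulrC.
pose G := GRing.isZmodMorphism.Build _ _ g gD.
pose ga : {additive loc p M -> V} := HB.pack g G.
exists ga => [|h hE] /=.
  by elim/fracW=> r s m; rewrite loc_tensE fE; exact: gE.
elim/fracW=> m s; transitivity (f (one s) m); last by rewrite gE.
by rewrite -hE loc_tensE scale1r.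
Qed.

End Tensor.

(* Under this identification the product of L_p is
   (x (x) a) (y (x) b) = xy (x) ab. *)
Lemma loc_tensM (R : comPzRingType) (p : spec R) (L : algebra R)
    (r r' : R) (s s' : den p) (a b : L) :
  let tens x y : loc_ring p L :=
    @loc_tens R p (restrict (alg_map L) L^o) x y in
  tens (frac (r : R^o) s) a * tens (frac (r' : R^o) s') b =
  tens (frac (r * r' : R^o) (den_mul s s')) (a * b).
Proof.
rewrite /= !loc_tensE; apply: (etrans (loc_mulE _ _ _ _)).
congr rfrac; rewrite !restrict_scaleE /GRing.scale /= rmorphM.
by rewrite -!mulrA; congr (_ * _); rewrite !mulrA alg_central.
Qed.

Definition spec_le (R : comPzRingType) (q p : spec R) : Prop :=
  forall x, x \in spec_set q -> x \in spec_set p.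

Section LocMap.
Variables (R : comPzRingType) (p q : spec R) (L : algebra R).
Variable qp : spec_le q p.

Fact den_incl_subproof (s : den p) : sval s \notin spec_set q.
Proof. by apply/negP => /qp; apply/negP; exact: (svalP s). Qed.

Definition den_incl (s : den p) : den q := exist _ (sval s) (den_incl_subproof s).

Definition loc_map (x : loc_ring p L) : loc_ring q L :=
  let: (a, s) := repr x in rfrac (a : L) (den_incl s).

Lemma loc_mapE a s : loc_map (rfrac a s) = rfrac a (den_incl s).
Proof.
rewrite /loc_map; have [u] := @frac_repr R p (restrict (alg_map L) L^o) a s.
rewrite -/(rfrac a s); case: (repr (rfrac a s)) => a' s' /= e.
by apply/rfracP; exists (den_incl u).
Qed.

Fact loc_map_zmod_morphism : zmod_morphism loc_map.
Proof.
have rN (p' : spec R) (a : L) (s : den p') : - rfrac a s = rfrac (- a) s.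
  exact: (@fracN R p' (restrict (alg_map L) L^o)).
elim/rfracW=> a s; elim/rfracW=> b t.
rewrite !loc_mapE !rN !rfracD loc_mapE /=.
by congr rfrac; apply: val_inj.
Qed.

Fact loc_map_monoid_morphism : monoid_morphism loc_map.
Proof.
split; first by rewrite -!rfrac1 loc_mapE; congr rfrac; apply: val_inj.
elim/rfracW=> a s; elim/rfracW=> b t; rewrite !loc_mapE !rfracM loc_mapE.
by congr rfrac; apply: val_inj.
Qed.

HB.instance Definition _ := GRing.isZmodMorphism.Build
  (loc_ring p L) (loc_ring q L) loc_map loc_map_zmod_morphism.
HB.instance Definition _ := GRing.isMonoidMorphism.Build
  (loc_ring p L) (loc_ring q L) loc_map loc_map_monoid_morphism.

End LocMap.

Section SimPoset.
Variables (R : comPzRingType) (L : algebra R).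

(* C_p = { X_p | X in C }, up to isomorphism. *)
Definition loc_class (C : lmodType L -> Prop) (p : spec R)
    (Y : lmodType (loc_ring p L)) : Prop :=
  exists2 X : lmodType L, C X & isomorphic (loc_mod p X) Y.

Definition Sim_R : Type := {p : spec R & sim (loc_ring p L)}.

Definition Sim_le (x y : Sim_R) : Prop :=
  exists (qp : spec_le (tag y) (tag x)),
  exists (S : lmodType (loc_ring (tag x) L)) (T : lmodType (loc_ring (tag y) L)),
    [/\ tagged x S, tagged y T & subfactor S (restrict (@loc_map R _ _ L qp) T)].

End SimPoset.

Lemma spec_eqP (R : comPzRingType) (p q : spec R) : spec_le p q -> spec_le q p -> p = q.
Proof.
case: p q => [p p1 p2 p3] [q q1 q2 q3]; rewrite /spec_le /= => h1 h2.
have e : p = q.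
  by apply: funext => x; apply/idP/idP => [/h1|/h2].
by subst q; congr Spec; apply: Prop_irrelevance.
Qed.

Lemma loc_map_id (R : comPzRingType) (p : spec R) (L : algebra R)
  (h : spec_le p p) x : @loc_map R p p L h x = x.
Proof.
elim/rfracW: x => a s; rewrite loc_mapE; congr rfrac; exact: val_inj.
Qed.

Lemma Sim_le_refl (R : comPzRingType) (L : algebra R) (x : Sim_R L) : Sim_le x x.
Proof.
case: x => p c; have h : spec_le p p by [].
exists h; case: (simP c) => S simS cS; exists S, S.
have iS : c S by apply/cS; exists idfun; exists id.
split=> //=.
have l : linear (id : S -> restrict (@loc_map _ _ _ L h) S).
  by move=> a u v; rewrite restrict_scaleE /= loc_map_id.
pose G := GRing.isLinear.Build _ _ _ _ (id : S -> restrict (@loc_map _ _ _ L h) S) l.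
pose i : {linear S -> restrict (@loc_map _ _ _ L h) S} := HB.pack (id : S -> restrict (@loc_map _ _ _ L h) S) G.
exists S, i, idfun.
by split=> // y; exists y.
Qed.

Lemma Sim_le_antisym (R : comPzRingType) (L : algebra R) (x y : Sim_R L) :
  Sim_le x y -> Sim_le y x -> x = y.
Proof.
case: x y => p c [q d] xy [pq _]; move: (xy) => [qp _]; move: qp pq => /= qp pq.
have e := spec_eqP qp pq; subst q; congr existT.
case: xy => /= h [S [T [cS dT [U [i [r [iinj rsurj]]]]]]].
have simple A (e0 : sim A) (M : lmodType A) : e0 M -> simple_module M.
  case: (simP e0) => N [[x x0] hN] eN /eN [f [g fK gK]]; split.
    by exists (f x); apply: contra x0 => /eqP fx; apply/eqP/(can_inj fK); rewrite fx linear0.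
  move=> V [V0 Vl].
  case: (hN [pred y | f y \in V]).
    by split=> [|a u v]; rewrite !inE ?linear0 // linearP; apply: Vl.
    by move=> hV; left=> y yV; rewrite -(gK y) (hV (g y)) ?linear0 // inE /= gK.
  by move=> hV; right=> y; rewrite -(gK y); have := hV (g y); rewrite inE.
have [[s s0] _] := simple _ _ _ cS; have [_ simT] := simple _ _ _ dT.
have isurj : forall t : T, exists u, i u = t.
  case: (simT [pred t | `[< exists u, i u = t >]]).
  - split=> [|a u v]; rewrite !inE.
      by apply/asboolP; exists 0; rewrite linear0.
    move=> /asboolP[u' eu] /asboolP[v' ev]; apply/asboolP; exists (a *: u' + v').
    by rewrite linearP eu ev restrict_scaleE /= loc_map_id.
  - move=> h0; case: (rsurj s) => u ru; case/negP: s0; apply/eqP.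
    rewrite -ru (_ : u = 0) ?linear0 //; apply: iinj; rewrite linear0; apply: h0.
    by rewrite inE; apply/asboolP; exists u.
  - by move=> h1 t; apply/asboolP; have := h1 t; rewrite inE.
have rinj : injective r.
  case: (simT [pred t | `[< exists2 u, i u = t & r u = 0 >]]).
  - split=> [|a u v]; rewrite !inE.
      by apply/asboolP; exists 0; rewrite linear0.
    move=> /asboolP[u' eu ru] /asboolP[v' ev rv]; apply/asboolP.
    exists (a *: u' + v'); rewrite linearP ?eu ?ev ?ru ?rv ?scaler0 ?addr0 //.
    by rewrite restrict_scaleE /= loc_map_id.
  - move=> h0 u v ruv; apply/eqP; rewrite -subr_eq0; apply/eqP.
    apply: iinj; rewrite linear0; apply: h0; rewrite inE; apply/asboolP.
    by exists (u - v) => //; rewrite linearB /= ruv subrr.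
  - move=> h1; case: (rsurj s) => u ru; case/negP: s0; apply/eqP.
    have := h1 (i u : T); rewrite inE => /asboolP[v /iinj ->].
    by rewrite ru.
pose g t := r (projT1 (cid (isurj t))).
have gi u : g (i u) = r u.
  by rewrite /g; case: cid => v /= /iinj ->.
have lg : linear (g : T -> S).
  move=> a t t'; have [u eu] := isurj t; have [u' eu'] := isurj t'.
  rewrite -eu -eu' !gi -linearP -gi linearP /=.
  by rewrite restrict_scaleE /= loc_map_id.
pose G := GRing.isLinear.Build _ _ _ _ (g : T -> S) lg.
pose g' : {linear T -> S} := HB.pack (g : T -> S) G.
have bg : bijective g'.
  pose k x := i (projT1 (cid (rsurj x))) : T.
  exists k => [t|x].
    have [u <-] := isurj t; rewrite /k; case: cid => v /= ev.
    by congr (i _); apply: rinj; rewrite ev; exact: gi.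
  by rewrite /k; case: cid => v /= ev; rewrite -[RHS]ev; exact: gi.
apply: (@sim_eqP _ c d S) => //.
case: (simP d) => N _ eN; apply/eN; apply: (@iso_trans _ _ T); first exact/eN.
by exists g'.
Qed.

Section Pullback.
Variables (A : pzRingType) (M N P : lmodType A).
Variables (f : {linear M -> P}) (g : {linear N -> P}).

Definition pullback_pred := [pred x : M * N | f x.1 == g x.2].

Fact pullback_closed : GRing.submod_closed pullback_pred.
Proof.
split=> [|a [x y] [x' y']]; rewrite !inE /= ?linear0 //.
by move=> /eqP e /eqP e'; rewrite !linearP e e'.
Qed.

HB.instance Definition _ := GRing.isSubmodClosed.Build A (M * N)%type
  pullback_pred (GRing.submod_closed_semi pullback_closed).

Definition pullback : Type := {x : M * N | x \in pullback_pred}.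
HB.instance Definition _ := SubChoice.on pullback.
HB.instance Definition _ := [SubChoice_isSubLmodule of pullback by <:].

Definition pullback_l (k : pullback) : M := (val k).1.
Definition pullback_r (k : pullback) : N := (val k).2.

Fact pullback_l_linear : linear pullback_l. Proof. by []. Qed.
Fact pullback_r_linear : linear pullback_r. Proof. by []. Qed.
HB.instance Definition _ := GRing.isLinear.Build A pullback M _ _ pullback_l_linear.
HB.instance Definition _ := GRing.isLinear.Build A pullback N _ _ pullback_r_linear.

End Pullback.

Lemma restrict_linear (A B : pzRingType) (h : {rmorphism A -> B}) (M N : lmodType B)
  (f : {linear M -> N}) : exists f' : {linear restrict h M -> restrict h N}, forall x, f' x = f x.
Proof.
have l : linear (f : restrict h M -> restrict h N).
  by move=> a u v; rewrite !restrict_scaleE -linearP.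
pose G := GRing.isLinear.Build _ _ _ _ (f : restrict h M -> restrict h N) l.
pose f' : {linear restrict h M -> restrict h N} := HB.pack (f : restrict h M -> restrict h N) G.
by exists f'.
Qed.

Lemma Sim_le_trans (R : comPzRingType) (L : algebra R) (x y z : Sim_R L) :
  Sim_le x y -> Sim_le y z -> Sim_le x z.
Proof.
case: x y z => p c [q d] [r e] /= [/= qp [S [T /= [cS dT [U [i [s [ii ss]]]]]]]].
move=> [/= rq [T' [V /= [dT' eV [W [j [t [jj tt]]]]]]]].
have rp : spec_le r p by move=> x /rq /qp.
exists rp, S, V; split=> //=.
case: (simP d) => T0 _ dT0.
have [f [f' fK f'K]] : isomorphic T' T by apply: (iso_trans (iso_sym (proj1 (dT0 _) dT')) (proj1 (dT0 _) dT)).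
have [t' t'E] := restrict_linear (@loc_map _ _ _ L qp) (f \o t).
have [j' j'E] := restrict_linear (@loc_map _ _ _ L qp) j.
pose k (v : restrict (@loc_map _ _ _ L qp) (restrict (@loc_map _ _ _ L rq) V)) :
  restrict (@loc_map _ _ _ L rp) V := v.
have lk : linear k.
  move=> a u v.
  change (loc_map rq (loc_map qp a) *: (u : V) + v = loc_map rp a *: (u : V) + v).
  congr (_ *: _ + _).
  elim/rfracW: a => a b; rewrite !loc_mapE; congr rfrac; exact: val_inj.
pose k' : {linear _ -> _} := HB.pack k (GRing.isLinear.Build _ _ _ _ k lk).
exists (pullback t' i), (k' \o j' \o @pullback_l _ _ _ _ t' i), (s \o @pullback_r _ _ _ _ t' i).
split=> [[[w u] uP] [[w' u'] uP']|y] /=.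
  rewrite /k /= !j'E => /jj; rewrite /pullback_l /= => ww.
  apply: val_inj => /=; subst w'; congr (_, _); apply: ii.
  by move: uP uP'; rewrite !inE /= => /eqP <- /eqP <-.
have [u <-] := ss y; have [w wE] := tt (f' (i u)).
have P : (w, u) \in pullback_pred t' i by rewrite inE /= t'E /= wE f'K.
by exists (exist _ (w, u) P).
Qed.

Record downset (X : Type) (le : X -> X -> Prop) := Downset {
  down_mem :> X -> Prop;
  downP : forall a b, le a b -> down_mem b -> down_mem a
}.

Definition downset_le (X : Type) (le : X -> X -> Prop) (U V : downset le) : Prop :=
  forall x, U x -> V x.

Definition poset_isomorphism (X Y : Type) (leX : X -> X -> Prop)
    (leY : Y -> Y -> Prop) (f : X -> Y) : Prop :=
  bijective f /\ forall x x', leX x x' <-> leY (f x) (f x').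

(* Main.v *)
(** A simple L_p-module S with a nonzero element s is the localization of the
   cyclic L-module L/ann(s).  Hence, for a Serre subcategory C, the class of S is
   in the image of C iff some X in C has an element x with ann(x) <= ann(s), and
   this criterion makes no further use of localized maps.

   Suppose that C and D have nested images but X in C is not in D.  By
   noetherianity X may be replaced by a quotient all of whose proper quotients are
   in D.  Then every r in R acts on X by zero or injectively, so p = ann_R(X) is
   prime and X embeds in X_p, which is finite-dimensional over the residue field.
   A minimal submodule of X_p is the localization of some cyclic L x in X, and the
   criterion puts L x in D; since X/Lx is in D too, so is X.

   A down-set W is the image of the category of those X such that W contains
   every S meeting the criterion for X.  For S in W, the module L/ann(s) lies in
   it because p kills S (Nakayama): a simple L_q-module meeting the criterion for
   L/ann(s) then has p <= q and is a subfactor of S. *)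

Require Import Defs.
From HB Require Import structures.
From mathcomp Require Import all_boot all_algebra.
From mathcomp Require Import boolp ring.

Set Implicit Arguments.
Unset Strict Implicit.
Unset Printing Implicit Defensive.

Import GRing.Theory.
Local Open Scope ring_scope.
Local Open Scope quotient_scope.

(** * Submodules, quotients and cyclic modules *)

Section Modules.
Variable A : pzRingType.
Implicit Types M N Q : lmodType A.

Definition submodule M (U : M -> Prop) : Prop :=
  U 0 /\ forall a x y, U x -> U y -> U (a *: x + y).

Lemma submoduleD M (U : M -> Prop) x y : submodule U -> U x -> U y -> U (x + y).
Proof. by case=> _ h Ux Uy; rewrite -(scale1r x); exact: h. Qed.

Lemma submoduleZ M (U : M -> Prop) a x : submodule U -> U x -> U (a *: x).
Proof. by case=> h0 h Ux; rewrite -(addr0 (_ *: _)); exact: h. Qed.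

Lemma submoduleB M (U : M -> Prop) x y : submodule U -> U x -> U y -> U (x - y).
Proof.
by move=> h Ux Uy; apply: submoduleD => //; rewrite -scaleN1r; exact: submoduleZ.
Qed.

Lemma submodule_sum M (U : M -> Prop) (I : Type) (r : seq I) (F : I -> M) :
  submodule U -> (forall i, U (F i)) -> U (\sum_(i <- r) F i).
Proof.
by move=> hU hF; elim/big_ind: _ => [|x y|//]; [case: hU|exact: submoduleD].
Qed.

Lemma submod_closed_asbool M (U : M -> Prop) :
  submodule U -> GRing.submod_closed [pred x | `[< U x >]].
Proof.
case=> h0 h; split=> [|a x y]; rewrite !inE; first exact/asboolP.
by move=> /asboolP Ux /asboolP Uy; apply/asboolP; exact: h.
Qed.

Lemma simple_submodule M (U : M -> Prop) : simple_module M -> submodule U ->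
  (forall x, U x -> x = 0) \/ (forall x, U x).
Proof.
case=> _ hM hU; case: (hM _ (submod_closed_asbool hU)) => h; [left|right] => x.
  by move=> Ux; apply: h; rewrite inE; apply/asboolP.
by have := h x; rewrite inE => /asboolP.
Qed.

Lemma mk_linear M N (f : M -> N) : linear f -> exists f' : {linear M -> N}, f' =1 f.
Proof.
move=> l; pose G := GRing.isLinear.Build _ _ _ _ f l.
by pose f' : {linear M -> N} := HB.pack f G; exists f'.
Qed.

Section Quotient.
Variables (M : lmodType A) (U : M -> Prop) (hU : submodule U).

(** The proof of [submodule U] is a parameter so that the closure instance declared next can be
    inferred from the predicate itself. *)
Definition submodule_pred of submodule U : {pred M} := [pred x | `[< U x >]].
HB.instance Definition _ := GRing.isSubmodClosed.Build A M (submodule_pred hU)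
  (GRing.submod_closed_semi (submod_closed_asbool hU)).

Definition quotient : Type := Quotient.quot (submodule_pred hU).
HB.instance Definition _ := GRing.Zmodule.on quotient.

Definition quotient_pi (x : M) : quotient :=
  \pi_(Quotient.quot (submodule_pred hU)) x.

Lemma quotient_piP x y : quotient_pi x = quotient_pi y <-> U (x - y).
Proof.
have e := Quotient.idealrBE (submodule_pred hU) x y.
split=> [/eqP h|/asboolP h]; first by apply/asboolP; exact: etrans e h.
exact/eqP/(etrans (esym e)).
Qed.

Lemma quotient_piW (P : quotient -> Prop) :
  (forall x, P (quotient_pi x)) -> forall q, P q.
Proof. by move=> h; elim/quotW. Qed.

Lemma quotient_piD x y : quotient_pi (x + y) = quotient_pi x + quotient_pi y.
Proof. exact: Quotient.pi_add. Qed.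

Definition quotient_scale a (q : quotient) : quotient :=
  quotient_pi (a *: repr (q : Quotient.quot (submodule_pred hU))).

Lemma quotient_scaleE a x : quotient_scale a (quotient_pi x) = quotient_pi (a *: x).
Proof.
apply/quotient_piP; rewrite -scalerBr; apply: submoduleZ => //.
by apply/quotient_piP; exact: reprK.
Qed.

Fact quotient_scaleA a b q :
  quotient_scale a (quotient_scale b q) = quotient_scale (a * b) q.
Proof. by elim/quotient_piW: q => x; rewrite !quotient_scaleE scalerA. Qed.

Fact quotient_scale1 : left_id 1 quotient_scale.
Proof. by elim/quotient_piW=> x; rewrite quotient_scaleE scale1r. Qed.

Fact quotient_scaleDr : right_distributive quotient_scale +%R.
Proof.
move=> a; elim/quotient_piW=> x; elim/quotient_piW=> y.
by rewrite -quotient_piD !quotient_scaleE scalerDr quotient_piD.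
Qed.

Fact quotient_scaleDl q : {morph quotient_scale^~ q : a b / a + b}.
Proof.
by move=> a b; elim/quotient_piW: q => x; rewrite !quotient_scaleE scalerDl quotient_piD.
Qed.

HB.instance Definition _ := GRing.Zmodule_isLmodule.Build A quotient
  quotient_scaleA quotient_scale1 quotient_scaleDr quotient_scaleDl.

End Quotient.

Lemma quotient_exists M (U : M -> Prop) : submodule U ->
  exists (Q : lmodType A) (f : {linear M -> Q}),
    surjective f /\ forall x, f x = 0 <-> U x.
Proof.
move=> hU; have l : linear (@quotient_pi M U hU).
  by move=> a x y; rewrite quotient_piD -quotient_scaleE.
have [f fE] := mk_linear l; exists (quotient hU), f; split.
  by elim/quotient_piW=> x; exists x; rewrite fE.
by move=> x; rewrite fE -(linear0 f) fE quotient_piP subr0.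
Qed.

Lemma linear_factor M N Q (f : {linear M -> Q}) (g : {linear M -> N}) :
  surjective f -> (forall x, f x = 0 -> g x = 0) ->
  exists h : {linear Q -> N}, forall x, h (f x) = g x.
Proof.
move=> sf fg; pose k q := g (projT1 (cid (sf q))).
have kE x : k (f x) = g x.
  rewrite /k; case: cid => y /= e; apply/eqP; rewrite -subr_eq0 -linearB /= fg //.
  by rewrite linearB /= e subrr.
have l : linear k.
  move=> a p q; have [x <-] := sf p; have [y <-] := sf q.
  by rewrite !kE -linearP kE linearP.
by have [h hE] := mk_linear l; exists h => x; rewrite hE.
Qed.

Definition generates M (e : M) : Prop := forall x, exists a, x = a *: e.

(** Both modules receive a map from [A]; the one given by [y] factors through the one given by
    [e]. *)
Lemma cyclic_map M N (e : M) (y : N) :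
  generates e -> (forall a, a *: e = 0 -> a *: y = 0) ->
  exists f : {linear M -> N}, forall a, f (a *: e) = a *: y.
Proof.
move=> ge ey.
have lin (K : lmodType A) (z : K) : linear (fun a : A^o => (a : A) *: z : K).
  by move=> a b c; rewrite scalerDl -scalerA.
have [f fE] := mk_linear (lin _ e); have [g gE] := mk_linear (lin _ y).
have [|a|h hE] := @linear_factor A^o N M f g.
- by move=> x; have [a ->] := ge x; exists a; rewrite fE.
- by rewrite fE gE; exact: ey.
- by exists h => a; rewrite -gE -hE fE.
Qed.

Lemma generates_surjective M N (f : {linear M -> N}) (e : M) (y : N) :
  generates y -> (forall a, f (a *: e) = a *: y) -> surjective f.
Proof. by move=> gy fE z; have [a ->] := gy z; exists (a *: e). Qed.

Lemma injective_ker M N (f : {linear M -> N}) :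
  (forall x, f x = 0 -> x = 0) -> injective f.
Proof.
move=> h x y e; apply/eqP; rewrite -subr_eq0; apply/eqP/h.
by rewrite linearB /= e subrr.
Qed.

Lemma cyclic_iso M N (e : M) (y : N) : generates e -> generates y ->
  (forall a, a *: e = 0 <-> a *: y = 0) -> isomorphic M N.
Proof.
move=> ge gy ey.
have [f fE] := cyclic_map ge (fun a => proj1 (ey a)).
have [g gE] := cyclic_map gy (fun a => proj2 (ey a)).
exists f; exists g => x.
  by have [a ->] := ge x; rewrite fE gE.
by have [a ->] := gy x; rewrite gE fE.
Qed.

Lemma generates_fg M (e : M) : generates e -> finitely_generated M.
Proof.
move=> ge; exists 1, (fun=> e); split=> // x _; have [a ->] := ge x.
by exists (fun=> a); rewrite big_ord1.
Qed.

Lemma simple_generates M (s : M) : simple_module M -> s != 0 -> generates s.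
Proof.
move=> hM s0; have [|h|//] := simple_submodule (U := fun x => exists a, x = a *: s) hM.
  split; first by exists 0; rewrite scale0r.
  by move=> a _ _ [b ->] [c ->]; exists (a * b + c); rewrite scalerDl scalerA.
by case/eqP: s0; apply: h; exists 1; rewrite scale1r.
Qed.

Lemma cyclic_exists (J : A -> Prop) : submodule (M := A^o) J ->
  exists (Q : lmodType A) (e : Q), generates e /\ forall a, a *: e = 0 <-> J a.
Proof.
move=> hJ; have [Q [f [sf kf]]] := quotient_exists hJ.
have fE a : (a : A) *: (f (1 : A^o)) = f (a : A^o).
  by rewrite -linearZ; congr (f _); rewrite /GRing.scale /= mulr1.
exists Q, (f (1 : A^o)); split=> [q|a]; last by rewrite fE kf.
by have [a <-] := sf q; exists a; rewrite fE.
Qed.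

Lemma ann_submodule M (x : M) : submodule (M := A^o) (fun a : A => a *: x = 0).
Proof.
split; first by rewrite scale0r.
by move=> a b c hb hc; rewrite scalerDl -scalerA hb hc scaler0 addr0.
Qed.

Lemma quotient_fg M N (f : {linear M -> N}) :
  surjective f -> finitely_generated M -> finitely_generated N.
Proof.
move=> sf [n [g [_ gM]]]; exists n, (f \o g); split=> // y _; have [x <-] := sf y.
have [//|c ->] := gM x; exists c; rewrite linear_sum.
by apply: eq_bigr => i _; rewrite linearZ.
Qed.

(** The submodule of [M] generated by [x] is A/ann(x), and [N], being A/ann(e), is a quotient of
    it. *)
Lemma serre_cyclic (C : serre A) M N (x : M) (e : N) : generates e ->
  (forall a, a *: x = 0 -> a *: e = 0) -> C M -> C N.
Proof.
move=> ge xe CM; have [Q [q [gq qx]]] := cyclic_exists (ann_submodule x).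
have [i iE] := cyclic_map gq (fun a => proj1 (qx a)).
have [a|f fE] := @cyclic_map _ _ q e gq; first by rewrite qx; exact: xe.
apply: (serre_quot (serreP C) (generates_fg ge) (generates_surjective ge fE)).
apply: (serre_sub (serreP C) (generates_fg gq) _ CM (f := i)).
apply: injective_ker => y; have [a ->] := gq y.
by rewrite iE -qx.
Qed.

Lemma range_submodule M N (f : {linear M -> N}) :
  submodule (fun y => exists x, f x = y).
Proof.
split; first by exists 0; rewrite linear0.
by move=> a _ _ [x <-] [y <-]; exists (a *: x + y); rewrite linearP.
Qed.

Lemma ker_submodule M N (f : {linear M -> N}) : submodule (fun x => f x = 0).
Proof. by split=> [|a x y ex ey]; rewrite ?linear0 // linearP ex ey scaler0 addr0. Qed.

End Modules.

(** * Chain conditions *)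

Section Span.
Variables (R : comPzRingType) (M : lmodType R).
Implicit Types (gs : seq M) (x y : M) (U : M -> Prop).

Fixpoint span gs x : Prop :=
  if gs is g :: gs' then exists r, span gs' (x - r *: g) else x = 0.

Lemma span_submodule gs : submodule (span gs).
Proof.
elim: gs => [|g gs IH] /=; first by split=> [|a x y -> ->]; rewrite ?scaler0 ?addr0.
split; first by exists 0; rewrite scale0r subr0; exact: proj1 IH.
move=> a x y [r hr] [s hs]; exists (a * r + s).
rewrite (_ : _ - _ = a *: (x - r *: g) + (y - s *: g)); first exact: (proj2 IH).
by rewrite scalerDl -scalerA scalerBr opprD addrACA.
Qed.

Lemma span_mem gs g : g \in gs -> span gs g.
Proof.
elim: gs => //= h gs IH; rewrite inE => /orP[/eqP->|/IH hg].
  by exists 1; rewrite scale1r subrr; case: (span_submodule gs).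
by exists 0; rewrite scale0r subr0.
Qed.

End Span.

(** Without a maximal member, choice yields a strictly ascending chain in [F]. Its union is a
    finitely generated ideal, so all the generators lie in one stage, and the next stage cannot be
    larger. *)
Lemma noetherian_ideal_max (R : comPzRingType) (F : (R -> Prop) -> Prop) :
  noetherian R ->
  (forall I, F I -> submodule (M := R^o) I) -> (exists I, F I) ->
  exists2 I, F I & forall J, F J -> (forall r, I r -> J r) -> forall r, J r -> I r.
Proof.
move=> hR Fsub [I0 FI0]; apply: contrapT => noMax.
have step (I : {I | F I}) : exists J : {I | F I},
    (forall r, sval I r -> sval J r) /\ exists2 r, sval J r & ~ sval I r.
  apply: contrapT => h; apply: noMax; exists (sval I) => [|J FJ IJ r Jr].
    exact: svalP.
  apply: contrapT => Ir; apply: h; exists (exist _ J FJ); split=> //.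
  by exists r.
pose next I := projT1 (cid (step I)).
have nextP I : (forall r, sval I r -> sval (next I) r) /\
    exists2 r, sval (next I) r & ~ sval I r by rewrite /next; case: cid.
pose c n := sval (iter n next (exist _ I0 FI0)).
have c_mono m n r : (m <= n)%N -> c m r -> c n r.
  move=> /subnK <-; elim: (n - m)%N => // k IH /IH; exact: (proj1 (nextP _)).
have c_sub n : submodule (M := R^o) (c n) by apply: Fsub; exact: svalP.
have Usub : submodule (M := R^o) (fun r : R^o => exists n, c n r).
  split; first by exists 0; case: (c_sub 0).
  move=> a x y [m hm] [n hn]; exists (maxn m n); apply: (proj2 (c_sub _)).
    by apply: c_mono hm; exact: leq_maxl.
  by apply: c_mono hn; exact: leq_maxr.
have [n [g [gU gen]]] := hR _ (submod_closed_asbool Usub).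
have {}gU i : exists k, c k (g i) by have := gU i; rewrite inE => /asboolP.
pose k i := projT1 (cid (gU i)).
have gk i : c (\max_i k i) (g i).
  by apply: (@c_mono (k i)); [exact: leq_bigmax|rewrite /k; case: cid].
have [_ [r hr []]] := nextP (iter (\max_i k i) next (exist _ I0 FI0)).
have [|b ->] := gen r; first by rewrite inE; apply/asboolP; exists (\max_i k i).+1.
apply: (@submodule_sum _ R^o (c _) _ _ _ (c_sub _)) => i.
exact: (submoduleZ _ (c_sub _)).
Qed.

(** A submodule is split into its ideal of leading coefficients at [g] and its intersection with the
    span of the other generators. If neither grows from [U] to a larger [V], then [V] is [U]: an
    element of [V] and one of [U] with the same leading coefficient differ by an element of the
    intersection. *)
Lemma noetherian_span_max (R : comPzRingType) (M : lmodType R) (gs : seq M)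
    (F : (M -> Prop) -> Prop) :
  noetherian R ->
  (forall U, F U -> submodule U /\ forall x, U x -> span gs x) ->
  (exists U, F U) ->
  exists2 U, F U & forall V, F V -> (forall x, U x -> V x) -> forall x, V x -> U x.
Proof.
move=> hR; elim: gs F => [|g gs IH] F Fsub [U0 FU0].
  exists U0 => // V FV _ x /(proj2 (Fsub _ FV)) /= ->.
  by case: (Fsub _ FU0) => -[].
pose lead (U : M -> Prop) (r : R) := exists2 x, U x & span gs (x - r *: g).
have leadS U V r : (forall x, U x -> V x) -> lead U r -> lead V r.
  by move=> h [x Ux hx]; exists x => //; exact: h.
have [_ [U1 [FU1 ->]] maxU1] : exists2 I, (exists U, F U /\ I = lead U) &
    forall J, (exists U, F U /\ J = lead U) -> (forall r, I r -> J r) ->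
    forall r, J r -> I r.
  apply: (noetherian_ideal_max hR); last by exists (lead U0), U0.
  move=> _ [U [/Fsub[hU _] ->]]; split.
    by exists 0; [case: hU|rewrite scale0r subr0; case: (span_submodule gs)].
  move=> a r s [x Ux hx] [y Uy hy]; exists (a *: x + y); first exact: (proj2 hU).
  rewrite (_ : _ - _ = a *: (x - r *: g) + (y - s *: g)).
    exact: (proj2 (span_submodule gs)).
  by rewrite scalerDl scalerBr -scalerA opprD addrACA.
pose G W := exists U, [/\ F U, forall x, U1 x -> U x & W = fun x => U x /\ span gs x].
have [||_ [U2 [FU2 U12 ->]] maxU2] := @IH G.
- move=> _ [U [/Fsub[hU _] _ ->]]; split=> [|x []//]; split.
    by split; [case: hU|case: (span_submodule gs)].
  move=> a x y [Ux hx] [Uy hy].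
  by split; [exact: (proj2 hU)|exact: (proj2 (span_submodule gs))].
- by exists (fun x => U1 x /\ span gs x), U1; split.
exists U2 => // V FV U2V x Vx; have [hV Vg] := Fsub _ FV; have [hU2 _] := Fsub _ FU2.
have [r hr] := Vg _ Vx.
have [|s||y U1y hy] := maxU1 (lead V) _ _ r _.
- by exists V.
- by apply: leadS => z /U12 /U2V.
- by exists x.
have [|z||U2xy _] := maxU2 (fun x => V x /\ span gs x) _ _ (x - y) _.
- by exists V; split=> // z /U12 /U2V.
- by case=> /U2V.
- split; first by apply: submoduleB => //; exact/U2V/U12.
  rewrite (_ : x - y = (x - r *: g) - (y - r *: g)).
    exact: (submoduleB (span_submodule gs)).
  by rewrite opprB subrKA.
by rewrite -(subrK y x); apply: submoduleD => //; exact: U12.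
Qed.

(** * Submodules up to denominators outside a prime *)

Section LocalSpan.
Variables (R : comPzRingType) (p : spec R) (M : lmodType R).

(** This is membership of x/1 in the R_p-span of [gs] in M_p, with denominators cleared. *)
Definition local_span (gs : seq M) (x : M) : Prop :=
  exists2 c, c \notin spec_set p & span gs (c *: x).

Definition saturated (U : M -> Prop) : Prop :=
  forall c x, c \notin spec_set p -> U (c *: x) -> U x.

Lemma notin_specM c d : c \notin spec_set p -> d \notin spec_set p ->
  c * d \notin spec_set p.
Proof. by move=> hc hd; apply/negP => /spec_prime /orP[]; exact/negP. Qed.

Lemma specM a r : r \in spec_set p -> a * r \in spec_set p.
Proof.
case: (spec_ideal p) => p0 pl pr.
by rewrite -[a * r]addr0; exact: (pl a r 0).
Qed.

Lemma notin_specB c r : c \notin spec_set p -> r \in spec_set p ->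
  c - r \notin spec_set p.
Proof.
move=> pc pr; apply: contra pc => h; rewrite -(subrK r c).
by rewrite -[c - r]mul1r; exact: (proj2 (spec_ideal p) 1).
Qed.

Lemma local_span_submodule gs : submodule (local_span gs).
Proof.
split; first by exists 1; [exact: spec_proper|rewrite scaler0; case: (span_submodule gs)].
move=> a x y [c pc hx] [d pd hy]; exists (c * d); first exact: notin_specM.
rewrite scalerDr !scalerA (_ : c * d * a = d * a * c); last by ring.
rewrite -!scalerA; have h := span_submodule gs.
by apply: submoduleD => //; do !apply: submoduleZ => //.
Qed.

Lemma local_span_saturated gs : saturated (local_span gs).
Proof.
move=> c x pc [d pd hx]; exists (d * c); first exact: notin_specM.
by rewrite -scalerA.
Qed.

(* When p kills M, the saturated submodules are the inverse images in M of the
   subspaces of M_p, a finite-dimensional vector space over the residue field. *)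
Lemma saturated_min gs (F : (M -> Prop) -> Prop) :
  (forall r (x : M), r \in spec_set p -> r *: x = 0) ->
  (forall U, F U ->
     [/\ submodule U, saturated U & forall x, U x -> local_span gs x]) ->
  (exists U, F U) ->
  exists2 U, F U & forall V, F V -> (forall x, V x -> U x) -> forall x, U x -> V x.
Proof.
move=> kill; elim: gs F => [|g gs IH] F Fsub [U0 FU0].
  exists U0 => // V /Fsub[[V0 _] satV _] _ x.
  by case: (Fsub _ FU0) => _ _ h /h[c pc /= e]; apply: (satV c) => //; rewrite e.
pose H := local_span gs.
have [hH satH] := (local_span_submodule gs, @local_span_saturated gs).
(* A minimal member among those inside [H] is minimal overall, since every member below it is inside
   [H] too. *)
have [[U1 [FU1 U1H]]|noU] := pselect (exists U, F U /\ forall x, U x -> H x).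
  have [||U [FU UH] minU] := IH (fun U => F U /\ forall x, U x -> H x).
  - by move=> U [/Fsub[]].
  - by exists U1.
  by exists U => // V FV VU; apply: (minU V) => //; split=> // x /VU /UH.
(* Otherwise every member has an element outside [H]. Modulo [H], the local span of [g :: gs] is at
   most a line, so it suffices to minimize the intersection with [H]. *)
have [||_ [U [FU ->]] minU] := IH (fun W => exists U, F U /\ W = fun x => U x /\ H x).
- move=> _ [U [/Fsub[hU satU _] ->]]; split=> [||x []//].
    split; first by case: hU; case: hH.
    by move=> a x y [Ux Hx] [Uy Hy]; split; [exact: (proj2 hU)|exact: (proj2 hH)].
  by move=> c x pc [Ux Hx]; split; [exact: satU Ux|exact: satH Hx].
- by exists (fun x => U0 x /\ H x), U0.
exists U => // V FV VU x Ux.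
have [hU satU Ug] := Fsub _ FU; have [hV satV Vg] := Fsub _ FV.
have [u Vu nHu] : exists2 u, V u & ~ H u.
  apply: contrapT => h; apply: noU; exists V; split=> // y Vy.
  by apply: contrapT => nHy; apply: h; exists y.
have [c pc [r hr]] := Vg _ Vu; have [d pd [s hs]] := Ug _ Ux.
(* [r] is the coefficient of [g] in [c *: u]; in [p] it would kill [g] and put [u] in [H]. *)
have pr : r \notin spec_set p.
  by apply/negP => pr; apply: nHu; exists c => //; rewrite (kill r g pr) subr0 in hr.
(* Eliminating [g] between [d *: x] and [c *: u] leaves an element of [U] inside [H], hence of
   [V]. *)
have Hy : H (r * d *: x - s * c *: u).
  exists 1; [exact: spec_proper|rewrite scale1r].
  rewrite (_ : _ - _ = r *: (d *: x - s *: g) - s *: (c *: u - r *: g)).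
    by apply: (submoduleB (span_submodule gs)); apply: (submoduleZ _ (span_submodule gs)).
  by rewrite !scalerBr !scalerA [s * r]mulrC opprB addrA subrK.
apply: (satV (r * d)); first exact: notin_specM.
rewrite -(subrK (s * c *: u) (r * d *: x)); apply: submoduleD => //;
  last exact: submoduleZ.
have [|z||//] := minU (fun x => V x /\ H x) _ _ (r * d *: x - s * c *: u) _.
- by exists V.
- by case=> /VU.
- by split=> //; apply: submoduleB => //; apply: submoduleZ => //; exact: VU.
Qed.

Lemma nakayama gs r : r \in spec_set p ->
  (forall x : M, exists y : M, x = r *: y) -> (forall x, local_span gs x) ->
  forall x : M, exists2 c, c \notin spec_set p & c *: x = 0.
Proof.
move=> pr div; elim: gs => [//|g gs IH] gen; apply: IH => x.
have [y gy] := div g; have [c pc [b hb]] := gen y; have [d pd [a ha]] := gen x.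
have sub := span_submodule gs.
have hg : span gs ((c - r * b) *: g).
  rewrite (_ : _ *: g = r *: (c *: y - b *: g)); first exact: submoduleZ.
  by rewrite scalerBl scalerBr !scalerA [r * c]mulrC -[c * r *: y]scalerA -gy.
have pe : c - r * b \notin spec_set p by apply: notin_specB; rewrite // mulrC specM.
exists ((c - r * b) * d); first exact: notin_specM.
rewrite -scalerA -[d *: x](subrK (a *: g)) scalerDr.
apply: (submoduleD sub); first exact: submoduleZ.
by rewrite scalerA mulrC -scalerA; exact: submoduleZ.
Qed.

End LocalSpan.

(** * Simple modules over the localizations *)

Section Localization.
Variables (R : comPzRingType) (L : algebra R) (p : spec R).
Implicit Types (X : lmodType L) (S T : lmodType (loc_ring p L)) (t : den p).

Definition loc_in (a : L) : loc_ring p L := rfrac a (den1 p).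

Fact loc_in_zmod_morphism : zmod_morphism loc_in.
Proof.
move=> a b; apply: (addIr (loc_in b)); rewrite subrK rfracD /=.
rewrite rmorph1 !mul1r subrK; apply: (congr1 (rfrac a)).
by apply: val_inj; rewrite /= mulr1.
Qed.

Fact loc_in_monoid_morphism : monoid_morphism loc_in.
Proof.
split=> // a b; rewrite rfracM; congr rfrac.
by apply: val_inj; rewrite /= mulr1.
Qed.

HB.instance Definition _ := GRing.isZmodMorphism.Build
  L (loc_ring p L) loc_in loc_in_zmod_morphism.
HB.instance Definition _ := GRing.isMonoidMorphism.Build
  L (loc_ring p L) loc_in loc_in_monoid_morphism.

Lemma rfracE a t : rfrac a t = rfrac 1 t * loc_in a.
Proof. by rewrite rfracM mul1r; congr rfrac; apply: val_inj; rewrite /= mulr1. Qed.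

Lemma rfrac1V (t : den p) : rfrac 1 t * loc_in (alg_map L (sval t)) = 1.
Proof.
rewrite -rfracE -rfrac1; apply/rfracP; exists (den1 p).
by rewrite /= !mul1r mulr1 rmorph1 mul1r.
Qed.

Lemma loc_scaler_eq0 S c (s : S) : c \notin spec_set p ->
  loc_in (alg_map L c) *: s = 0 -> s = 0.
Proof.
move=> pc h; rewrite -[s]scale1r -(rfrac1V (exist _ c pc)).
by rewrite -scalerA h scaler0.
Qed.

Lemma rfrac_scaler_eq0 S a t (s : S) : rfrac a t *: s = 0 <-> loc_in a *: s = 0.
Proof.
split=> [h|h]; last by rewrite rfracE -scalerA h scaler0.
have <- : loc_in (alg_map L (sval t)) * rfrac a t = loc_in a.
  rewrite rfracM; apply/rfracP; exists (den1 p).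
  by rewrite /= !mul1r rmorph1 mul1r.
by rewrite -scalerA h scaler0.
Qed.

Lemma mfrac0 X t : mfrac (0 : X) t = 0.
Proof.
have -> : (0 : loc_mod p X) = mfrac 0 (den1 p) by [].
by apply: mfrac_eq; rewrite !scaler0.
Qed.

Lemma mfrac_eq0 X (x : X) t :
  mfrac x t = 0 <-> exists2 c, c \notin spec_set p & alg_map L c *: x = 0.
Proof.
split=> [|[c pc e]].
  rewrite -(mfrac0 X t) => /mfracP[u]; rewrite scaler0 => e.
  by exists (sval u * sval t) => //; exact: (svalP (den_mul u t)).
rewrite -(mfrac0 X t); apply/mfracP; exists (exist _ c pc) => /=.
by rewrite scaler0 mulrC rmorphM -scalerA e scaler0.
Qed.

Lemma loc_in_mfrac X a (x : X) t : loc_in a *: mfrac x t = mfrac (a *: x) t.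
Proof. by rewrite mfracZ; congr mfrac; apply: val_inj; rewrite /= mul1r. Qed.

Lemma mfracE X (x : X) t : mfrac x t = rfrac 1 t *: mfrac x (den1 p).
Proof. by rewrite mfracZ scale1r; congr mfrac; apply: val_inj; rewrite /= mulr1. Qed.

Lemma mfrac_generates X (e : X) : generates e -> generates (mfrac e (den1 p)).
Proof.
move=> ge; elim/mfracW=> x t; have [a ->] := ge x; exists (rfrac a t).
by rewrite rfracE -scalerA loc_in_mfrac -mfracE.
Qed.

(** Both modules are cyclic over the localized ring, and their annihilators agree on numerators
    because a scalar outside [p] can be cancelled in [S]. *)
Lemma loc_cyclic_iso X S (e : X) (s : S) : generates e -> generates s ->
  (forall a, a *: e = 0 <-> loc_in a *: s = 0) -> isomorphic (loc_mod p X) S.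
Proof.
move=> ge gs es; apply: (cyclic_iso (mfrac_generates ge) gs).
elim/rfracW=> a t; rewrite !rfrac_scaler_eq0 loc_in_mfrac mfrac_eq0 -es.
split=> [[c pc]|h]; last by exists 1; [exact: spec_proper|rewrite h scaler0].
rewrite scalerA es rmorphM -scalerA; rewrite es; exact: loc_scaler_eq0.
Qed.

(** [x] is the numerator of the fraction that matches [s]. Together with [ann_loc_class] this is the
    criterion by annihilators. *)
Lemma loc_class_ann (C : lmodType L -> Prop) S (s : S) : loc_class C S ->
  exists X (x : X), C X /\ forall a, a *: x = 0 -> loc_in a *: s = 0.
Proof.
move=> [X CX [f [g fK gK]]]; move: (gK s); elim/mfracW: (g s) => x t <-.
exists X, x; split=> // a e.
by rewrite -linearZ /= loc_in_mfrac e mfrac0 linear0.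
Qed.

Lemma ann_loc_class (C : serre L) S X (x : X) (s : S) : simple_module S -> s != 0 ->
  C X -> (forall a, a *: x = 0 -> loc_in a *: s = 0) -> loc_class C S.
Proof.
move=> hS s0 CX xs.
(* [Q] is L/ann(s), with the annihilator taken in [L]; its localization is [S]. *)
have [Q [e [ge es]]] := cyclic_exists (ann_submodule (s : restrict loc_in S)).
exists Q; last exact: (loc_cyclic_iso ge (simple_generates hS s0)).
by apply: (serre_cyclic ge _ CX) => a /xs h; apply/es.
Qed.

Lemma loc_class_iso (C : lmodType L -> Prop) S T :
  isomorphic S T -> loc_class C S -> loc_class C T.
Proof. by move=> ST [X CX h]; exists X => //; exact: iso_trans ST. Qed.

End Localization.

Lemma loc_map_in (R : comPzRingType) (L : algebra R) (p q : spec R) (qp : spec_le q p) a :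
  loc_map qp (loc_in p a) = loc_in q a :> loc_ring q L.
Proof. by rewrite loc_mapE; congr rfrac; exact: val_inj. Qed.

Section SimpleClasses.
Variable A : pzRingType.

Lemma iso_refl (M : lmodType A) : isomorphic M M.
Proof. by exists idfun; exists id. Qed.

Lemma iso_simple (M N : lmodType A) :
  isomorphic M N -> simple_module M -> simple_module N.
Proof.
move=> [f [g fK gK]] [[x x0] hM]; split.
  by exists (f x); apply: contra x0 => /eqP e; rewrite -(fK x) -(fK 0) e linear0.
move=> V [V0 Vl]; case: (hM [pred y | f y \in V]).
- by split=> [|a u v]; rewrite !inE ?linear0 // linearP; exact: Vl.
- by move=> hV; left=> y yV; rewrite -(gK y) (hV (g y)) ?linear0 // inE /= gK.
- by move=> hV; right=> y; rewrite -(gK y); have := hV (g y); rewrite inE.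
Qed.

Lemma sim_simple (c : sim A) S : c S -> simple_module S.
Proof. by case: (simP c) => S0 hS0 cE /cE h; exact: iso_simple hS0. Qed.

Lemma sim_isomorphic (c : sim A) S T : c S -> c T -> isomorphic S T.
Proof. by case: (simP c) => S0 _ cE /cE h /cE h'; exact: iso_trans (iso_sym h) h'. Qed.

Lemma sim_nonempty (c : sim A) : exists S, c S.
Proof. by case: (simP c) => S _ cE; exists S; apply/cE; exact: iso_refl. Qed.

Lemma sim_exists S : simple_module S -> exists c : sim A, c S.
Proof.
move=> hS; have P : exists2 S0, simple_module S0 &
    forall T, isomorphic S T <-> isomorphic S0 T by exists S.
by exists (Sim P); exact: iso_refl.
Qed.

End SimpleClasses.

(** * The simples of a Serre subcategory *)

Section SerreSimples.
Variables (R : comPzRingType) (L : algebra R).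

Definition simples (C : lmodType L -> Prop) (x : Sim_R L) : Prop :=
  exists2 S, tagged x S & loc_class C S.

(** The criterion passes to subfactors: [s] lifts to some [u] in [U], and whatever in [L] kills
    [i u] kills [s]. *)
Lemma simples_down (C : serre L) (x y : Sim_R L) :
  Sim_le x y -> simples C y -> simples C x.
Proof.
case: x y => p c [q d] [/= qp [S [T [/= cS dT [U [i [f [ii sf]]]]]]]].
move=> [T' /= dT' CT']; exists S => //=.
have hS := sim_simple cS; have [[s s0] _] := hS; have [u us] := sf s.
have CT := loc_class_iso (sim_isomorphic dT' dT) CT'.
have [X [x [CX xu]]] := loc_class_ann (i u : T) CT.
apply: (ann_loc_class hS s0 CX (x := x)) => a /xu h.
rewrite -us -linearZ /= (_ : loc_in p a *: u = 0) ?linear0 //.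
apply: ii; rewrite linearZ linear0 /= restrict_scaleE.
by rewrite /= loc_map_in h.
Qed.

Definition all_quotients_in (D : serre L) (Y : lmodType L) : Prop :=
  forall (Z : lmodType L) (g : {linear Y -> Z}),
    surjective g -> (exists2 y, y != 0 & g y = 0) -> D Z.

(** [Y] is an extension of the proper quotient Y/f(N) by [N]. *)
Lemma serre_extend (D : serre L) (N Y : lmodType L) (f : {linear N -> Y}) (n : N) :
  finitely_generated Y -> all_quotients_in D Y -> D N -> injective f -> n != 0 -> D Y.
Proof.
move=> fgY hY DN fi n0.
have [Q [g [sg kg]]] := quotient_exists (range_submodule f).
apply: (serre_ext (serreP D) fgY fi sg _ DN) => [//|].
apply: hY sg _; exists (f n); last by apply/kg; exists n.
by apply: contra n0 => /eqP e; apply/eqP/fi; rewrite e linear0.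
Qed.

(** If [r] kills some nonzero element but not all of [Y], the proper quotient Y/ker(r) lies in [D]
    and embeds in [Y] as rY, which forces [Y] into [D] by [serre_extend]. *)
Lemma all_quotients_scalar (D : serre L) (Y : lmodType L) r :
  finitely_generated Y -> all_quotients_in D Y -> ~ D Y ->
  (forall y : Y, alg_map L r *: y = 0) \/
  (forall y : Y, alg_map L r *: y = 0 -> y = 0).
Proof.
move=> fgY hY nDY.
have l : linear (fun y : Y => alg_map L r *: y).
  by move=> a x y; rewrite scalerDr !scalerA alg_central.
have [f fE] := mk_linear l.
have [[y ry y0]|inj] :=
  pselect (exists2 y : Y, alg_map L r *: y = 0 & y <> 0); last first.
  by right=> y ry; apply: contrapT => y0; apply: inj; exists y.
left=> z; apply: contrapT => rz; apply: nDY.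
have [Q [g [sg kg]]] := quotient_exists (ker_submodule f).
have [x|h hE] := linear_factor sg (g := f); first by rewrite kg.
apply: (@serre_extend _ _ _ h (g z)) => //.
- by apply: hY sg _; exists y; [exact/eqP|rewrite kg fE].
- apply: injective_ker => q; have [x <-] := sg q.
  by rewrite hE kg.
- by apply/eqP; rewrite kg fE.
Qed.

(** Products of generators of [L] over [R] with generators of [X] over [L] span [X] over [R]. *)
Lemma fg_span (X : lmodType L) : noetherian_algebra L -> finitely_generated X ->
  exists gs : seq (restrict (alg_map L) X), forall x, span gs x.
Proof.
move=> [_ [m [h [_ hgen]]]] [n [g [_ ggen]]].
pose gs : seq (restrict (alg_map L) X) :=
  [seq (h i : L) *: g j | i <- enum 'I_m, j <- enum 'I_n].
exists gs => x; have hgs := span_submodule gs.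
have [//|c ->] := ggen x.
apply: (submodule_sum _ hgs) => j; have [//|b ->] := hgen (c j).
rewrite scaler_suml; apply: (submodule_sum _ hgs) => i.
rewrite restrict_scaleE -scalerA; apply: (submoduleZ _ hgs); apply: span_mem.
by apply/allpairsP; exists (i, j); rewrite !mem_enum.
Qed.

(** The kernel of [f] is chosen maximal among the kernels of quotients of [X] outside [D]. *)
Lemma noetherian_minimal_quotient (D : serre L) (X : lmodType L) :
  noetherian_algebra L -> finitely_generated X -> ~ D X ->
  exists (Y : lmodType L) (f : {linear X -> Y}),
    [/\ surjective f, ~ D Y & all_quotients_in D Y].
Proof.
move=> hL fgX nDX; have [gs gsP] := fg_span hL fgX.
pose F (U : restrict (alg_map L) X -> Prop) :=
  exists (Y : lmodType L) (f : {linear X -> Y}),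
    [/\ surjective f, ~ D Y & U = fun x => f x = 0].
have [U||_ [Y [f [sf nDY ->]]] max] := @noetherian_span_max _ _ gs F (proj1 hL).
- move=> [Y [f [_ _ ->]]]; split=> [|x _ //].
  have [h0 h] := ker_submodule f.
  by split=> // a x y; exact: h.
- by exists (fun x => (idfun : {linear X -> X}) x = 0), X, idfun; split=> // x; exists x.
exists Y, f; split=> // Z g sg [y y0 gy]; apply: contrapT => nDZ.
have [x xy] := sf y; case/eqP: y0; rewrite -xy.
apply: (max (fun x => (g \o f) x = 0)) => /=; last by rewrite xy.
  exists Z, (g \o f); split=> // z; have [v <-] := sg z; have [w <-] := sf v.
  by exists w.
by move=> w ->; rewrite linear0.
Qed.

End SerreSimples.

(** * Serre subcategories are determined by their simples *)

Section Reflection.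
Variables (R : comPzRingType) (L : algebra R) (hL : noetherian_algebra L).

(* [Y] is torsion-free over its annihilator prime [p], and [e] generates a copy
   of a submodule [L x] of [Y] whose localization at [p] is minimal in [Y_p]. *)
Lemma simple_localization (Y : lmodType L) :
  finitely_generated Y -> (exists y : Y, y != 0) ->
  (forall r, (forall y : Y, alg_map L r *: y = 0) \/
             (forall y : Y, alg_map L r *: y = 0 -> y = 0)) ->
  exists p (Q : lmodType L) (e : Q) (f : {linear Q -> Y}),
    [/\ generates e, e != 0, injective f, simple_module (loc_mod p Q) &
        forall q t, mfrac q t = 0 :> loc_mod p Q -> q = 0].
Proof.
move=> fgY [y0 ny0] dich.
(* The annihilator of [Y]; [dich] makes it prime and makes every scalar outside it injective on
   [Y]. *)
pose P := [pred r : R | `[< forall y : Y, alg_map L r *: y = 0 >]].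
have PP r : reflect (forall y : Y, alg_map L r *: y = 0) (r \in P).
  exact: asboolP.
have Pideal : GRing.submod_closed (P : {pred R^o}).
  split=> [|a x y]; first by apply/PP => y; rewrite rmorph0 scale0r.
  move=> /PP hx /PP hy; apply/PP => z.
  by rewrite rmorphD rmorphM scalerDl -scalerA hx hy scaler0 addr0.
have Pproper : 1 \notin P.
  by apply/PP => h; case/eqP: ny0; rewrite -(h y0) rmorph1 scale1r.
have Pprime x y : x * y \in P -> (x \in P) || (y \in P).
  move=> /PP hxy; case: (dich x) => [/PP-> //|hx]; apply/orP; right; apply/PP => z.
  by apply: hx; rewrite scalerA -rmorphM.
pose p : spec R := Spec Pideal Pproper Pprime.
have inj c (y : Y) : c \notin P -> alg_map L c *: y = 0 -> y = 0.
  by move=> pc; case: (dich c) => [/PP hc|]; [rewrite hc in pc|exact].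
have [gs gsP] := fg_span hL fgY.
(* Saturated [L]-submodules of [Y] stand for the submodules of Y_p, so a minimal member of [F]
   stands for a simple one. *)
pose F (U : restrict (alg_map L) Y -> Prop) :=
  [/\ submodule (M := Y) U, saturated p U & exists2 y : Y, y != 0 & U y].
have [r y /PP|U||U [hU satU [x nx Ux]] minU] :=
    @saturated_min _ p (restrict (alg_map L) Y) gs F.
- by apply.
- case=> hU satU _; split=> // [|y _].
    by case: hU => h0 h; split=> // a u v; exact: h.
  by exists 1; [exact: spec_proper|rewrite scale1r].
- by exists (fun=> True); split=> //; exists y0.
have [Q [e [ge ex]]] := cyclic_exists (ann_submodule x).
have [f fE] := cyclic_map ge (fun a => proj1 (ex a)).
have fi : injective f.
  by apply: injective_ker => q; have [a ->] := ge q; rewrite fE ex.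
have torsionfree q t : mfrac q t = 0 :> loc_mod p Q -> q = 0.
  move=> /mfrac_eq0[c pc cq]; apply: fi; rewrite linear0; apply: (inj c) => //.
  by rewrite -linearZ /= cq linear0.
have ne : e != 0.
  apply: contra nx => /eqP e0; rewrite -(scale1r x); apply/eqP/ex.
  by rewrite e0 scaler0.
exists p, Q, e, f; split=> //; split.
  by exists (mfrac e (den1 p)); apply: contra ne => /eqP /torsionfree ->.
move=> W [W0 Wl].
have WD u v : u \in W -> v \in W -> u + v \in W.
  by move=> Wu Wv; rewrite -(scale1r u); exact: Wl.
have WZ b u : u \in W -> b *: u \in W.
  by move=> Wu; rewrite -(addr0 (b *: u)); exact: Wl.
(* [V] is the inverse image in [Y] of [W], regarded inside Y_p through [f]. *)
pose V (y : restrict (alg_map L) Y) := exists c a,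
  [/\ c \notin spec_set p, alg_map L c *: (y : Y) = a *: (x : Y) &
      mfrac (a *: e) (den1 p) \in W].
have hV : submodule (M := Y) V.
  split.
    exists 1, 0; split; [exact: spec_proper|by rewrite scaler0 scale0r|].
    by rewrite scale0r mfrac0; exact: W0.
  move=> b u v [c [a [pc cu Wa]]] [d [a' [pd dv Wa']]].
  exists (c * d), (alg_map L d * b * a + alg_map L c * a'); split.
  - exact: notin_specM.
  - rewrite scalerDl -!scalerA -cu -dv scalerDr !scalerA !rmorphM.
    congr (_ *: _ + _ *: _).
    by rewrite -!mulrA -alg_central mulrA -alg_central !mulrA -!rmorphM mulrC.
  - rewrite scalerDl mfracDn -(scalerA _ a) -(scalerA _ a').
    rewrite -(loc_in_mfrac _ (a *: e)) -(loc_in_mfrac _ (a' *: e)).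
    by apply: WD; apply: WZ.
have satV : saturated p V.
  move=> d y pd [c [a [pc cy Wa]]]; exists (c * d), a; split=> //.
    exact: notin_specM.
  by rewrite rmorphM -scalerA.
have [[w Ww nw]|W_0] := pselect (exists2 w, w \in W & w <> 0); last first.
  by left=> w Ww; apply: contrapT => nw; apply: W_0; exists w.
(* A nonzero element of [W] has as numerator a multiple of [e] that [f] sends to a nonzero element
   of [V]. Since [V] lies in [U], minimality gives [V x]. *)
right; have Ve : V x.
  apply: (minU V) => //; last first.
    move=> y [c [a [pc cy _]]]; apply: (satU c) => //.
    by rewrite restrict_scaleE cy; exact: (submoduleZ _ hU).
  split=> //; move: w Ww nw; elim/mfracW=> q t; have [a ->] := ge q => Ww nw.
  exists (a *: (x : Y)).
    by apply/eqP => /ex e0; apply: nw; rewrite e0 mfrac0.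
  exists 1, a; split; [exact: spec_proper|by rewrite rmorph1 scale1r|].
  suff -> : mfrac (a *: e) (den1 p) = loc_in p (alg_map L (sval t)) *: mfrac (a *: e) t.
    exact: WZ.
  rewrite loc_in_mfrac; apply: mfrac_eq.
  by rewrite /= rmorph1 scale1r.
have [c [a [pc cx Wa]]] := Ve.
(* Here c e = a e, and [c] is invertible at [p]. *)
have We : mfrac e (den1 p) \in W.
  have -> : mfrac e (den1 p) = rfrac 1 (exist _ c pc) *: mfrac (a *: e) (den1 p).
    have -> : a *: e = alg_map L c *: e.
      apply/eqP; rewrite -subr_eq0 -scalerBl; apply/eqP/ex.
      by rewrite scalerBl -cx subrr.
    by rewrite -loc_in_mfrac scalerA (rfrac1V L (exist _ c pc : den p)) scale1r.
  exact: WZ.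
by move=> v; have [b ->] := mfrac_generates ge v; exact: WZ.
Qed.

Lemma simples_reflect (C D : serre L) :
  (forall x : Sim_R L, simples C x -> simples D x) -> serre_le C D.
Proof.
move=> CD X CX; apply: contrapT => nDX.
have fgX := serre_fg (serreP C) CX.
have [Y [g [sg nDY hY]]] := noetherian_minimal_quotient hL fgX nDX.
have fgY := quotient_fg sg fgX.
have [||p [Q [e [f [ge ne fi sQ tfQ]]]]] := simple_localization fgY.
- apply: contrapT => h; apply: nDY; apply: (serre_zero (serreP D)) => y.
  by apply: contrapT => /eqP y0; apply: h; exists y.
- by move=> r; exact: all_quotients_scalar hY nDY.
have CQ : C Q.
  apply: (serre_sub (serreP C) (generates_fg ge) fi).
  exact: (serre_quot (serreP C) fgY sg CX).
have [c cS] := sim_exists sQ.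
have [|S /= cS' DS] := CD (existT _ p c).
  by exists (loc_mod p Q) => //; exists Q => //; exact: iso_refl.
have {DS} := loc_class_iso (sim_isomorphic cS' cS) DS.
(* Since [Q] embeds in its localization, the criterion at e/1 becomes an inclusion of annihilators
   in [L], which puts [Q] in [D]. *)
move=> /(loc_class_ann (mfrac e (den1 p)))[Z [z [DZ ze]]].
apply: nDY; apply: (serre_extend fgY hY _ fi ne).
apply: (serre_cyclic ge (x := z)) DZ => a /ze.
by rewrite loc_in_mfrac => /tfQ.
Qed.

End Reflection.

(** * From down-sets to Serre subcategories *)

Section Construction.
Variables (R : comPzRingType) (L : algebra R) (hL : noetherian_algebra L).

Lemma loc_in_central (p : spec R) r (b : loc_ring p L) :
  loc_in p (alg_map L r) * b = b * loc_in p (alg_map L r).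
Proof.
elim/rfracW: b => a t; rewrite !rfracM alg_central; congr rfrac.
by apply: val_inj; rewrite /= mulrC.
Qed.

(* Otherwise r acts bijectively on S, against Nakayama's lemma. *)
Lemma simple_killed (p : spec R) (S : lmodType (loc_ring p L)) r (s : S) :
  simple_module S -> r \in spec_set p -> loc_in p (alg_map L r) *: s = 0.
Proof.
move=> hS pr; have [[s0 ns0] _] := hS.
have l : linear (fun x : S => loc_in p (alg_map L r) *: x).
  by move=> a x y; rewrite scalerDr !scalerA loc_in_central.
have [f fE] := mk_linear l; rewrite -fE.
have [kf|//] := simple_submodule hS (ker_submodule f).
have [rf|rf] := simple_submodule hS (range_submodule f); first by apply: rf; exists s.
case: hL => _ [n [h [_ hgen]]].
(* Over [R], and up to denominators, [S] is spanned by the multiples of [s0] by generators of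
   [L]. *)
pose M : lmodType R := restrict (loc_in p \o alg_map L) S.
pose gs : seq M := [seq (loc_in p (h i) *: s0 : S) | i <- enum 'I_n].
have [x|x|c pc e] := @nakayama _ p M gs r pr _ _ s; last first.
- by rewrite fE (loc_scaler_eq0 pc e) scaler0.
- have [b ->] := simple_generates hS ns0 x; elim/rfracW: b => a t.
  exists (sval t); first exact: (svalP t).
  rewrite restrict_scaleE /= scalerA loc_in_central rfracE -!mulrA -loc_in_central.
  rewrite !mulrA rfrac1V mul1r.
  have [//|b ->] := hgen a; rewrite rmorph_sum scaler_suml.
  apply: (submodule_sum _ (span_submodule gs)) => i.
  rewrite restrict_scaleE rmorphM -scalerA.
  apply: (submoduleZ _ (span_submodule gs)); apply: span_mem.
  by apply: map_f; rewrite mem_enum.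
- by have [y <-] := rf x; exists y; rewrite fE.
Qed.

(** The condition says that [W] contains every simple subfactor of every localization of [X]. Stated
    through annihilators, it lets the closure properties be checked on elements of [X]. *)
Definition serre_of_pred (W : Sim_R L -> Prop) (X : lmodType L) : Prop :=
  finitely_generated X /\
  forall p (c : sim (loc_ring p L)) S, c S ->
    forall (x : X) (s : S), s != 0 ->
      (forall a, a *: x = 0 -> loc_in p a *: s = 0) -> W (existT _ p c).

Lemma serre_of_predP (W : Sim_R L -> Prop) : is_serre (serre_of_pred W).
Proof.
have sub (X Y : lmodType L) (f : {linear X -> Y}) :
    finitely_generated X -> injective f -> serre_of_pred W Y -> serre_of_pred W X.
  move=> fgX fi [_ hY]; split=> // p c S cS x s s0 xs.
  apply: (hY p c S cS (f x) s s0) => a e; apply: xs; apply: fi.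
  by rewrite linearZ linear0.
split.
- by move=> X [].
- move=> X Y [f [g fK gK]] hX.
  have [|h [h' hK h'K]] := @iso_sym _ X Y; first by exists f; exists g.
  apply: (sub _ _ h) => //; last exact: can_inj hK.
  apply: (quotient_fg (f := f)); last by case: hX.
  by move=> y; exists (g y).
- move=> X X0; split.
    exists 0, (fun=> 0); split=> // x _; exists (fun=> 0).
    by rewrite big_ord0 (X0 x).
  move=> p c S cS x s s0 xs; case/eqP: s0; rewrite -[s]scale1r.
  by apply: (xs 1); rewrite (X0 (_ *: _)).
- exact: sub.
- move=> X Y f fgY sf [_ hX]; split=> // p c S cS y s s0 ys.
  have [x xy] := sf y; apply: (hX p c S cS x s s0) => a e; apply: ys.
  by rewrite -xy -linearZ /= e linear0.
- move=> X Y Z f g fgY fi sg ex [_ hX] [_ hZ]; split=> // p c S cS y s s0 ys.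
  (* If some [a] kills [g y] but not [s], then [a *: y] comes from [X] and is tested against the
     nonzero element a s; otherwise [g y] meets the criterion in [Z]. *)
  have [[a gay as0]|h] := pselect (exists2 a, a *: g y = 0 & loc_in p a *: s <> 0).
    have [x xy] : exists x, f x = a *: y by apply/ex; rewrite linearZ.
    apply: (hX p c S cS x (loc_in p a *: s)); first exact/eqP.
    move=> b bx; rewrite scalerA -rmorphM; apply: ys.
    by rewrite -scalerA -xy -linearZ /= bx linear0.
  apply: (hZ p c S cS (g y) s s0) => a e.
  by apply: contrapT => n; apply: h; exists a.
Qed.

Lemma simples_serre_of_pred (W : downset (@Sim_le R L)) x :
  simples (serre_of_pred W) x <-> W x.
Proof.
case: x => p c; split=> [[S /= cS CS]|Wx].
  have [[s s0] _] := sim_simple cS; have [X [x [[_ hX] xs]]] := loc_class_ann s CS.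
  exact: (hX p c S cS x s s0).
have [S cS] := sim_nonempty c; have hS := sim_simple cS; have [[s s0] _] := hS.
have [Q [e [ge es]]] := cyclic_exists (ann_submodule (s : restrict (loc_in p) S)).
exists S => //; exists Q; last exact: (loc_cyclic_iso ge (simple_generates hS s0)).
split=> [|q d T dT y t t0]; first exact: generates_fg ge.
have [a ->] := ge y => yt.
(* A scalar of [p] kills [e] by [simple_killed], hence kills [t]; outside [q] it would act
   injectively on [T]. *)
have pq : spec_le p q.
  move=> r pr; apply: contrapT => /negP qr; case/eqP: t0.
  apply: (loc_scaler_eq0 qr); apply: yt; rewrite scalerA alg_central -scalerA.
  by rewrite (_ : alg_map L r *: e = 0) ?scaler0 //; apply/es/simple_killed.
apply: (downP _ Wx); exists pq, T, S; split=> //=.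
(* [T] is the quotient, with [u] sent to [t], of the L_q-submodule of [S] generated by a s. *)
pose y' : restrict (@loc_map _ _ _ L pq) S := loc_in p a *: s.
have [U [u [gu uy']]] := cyclic_exists (ann_submodule y').
have [i iE] := cyclic_map gu (fun b => proj1 (uy' b)).
have [|f fE] := @cyclic_map _ U T u t gu.
  move=> b /uy'; elim/rfracW: b => b v.
  rewrite restrict_scaleE /= loc_mapE => h.
  have {}h := proj1 (rfrac_scaler_eq0 _ _ (y' : S)) h.
  apply/rfrac_scaler_eq0/yt; rewrite scalerA; apply/es.
  by rewrite restrict_scaleE rmorphM -scalerA.
exists U, i, f; split.
  by apply: injective_ker => z; have [b ->] := gu z; rewrite iE => /uy'.
exact: generates_surjective (simple_generates (sim_simple dT) t0) fE.
Qed.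

End Construction.

(** * The isomorphism of posets *)

Lemma downset_eq (X : Type) (le : X -> X -> Prop) (U V : downset le) :
  (forall x, U x <-> V x) -> U = V.
Proof.
case: U V => U hU [V hV] /= h.
have e : U = V by apply: funext => x; apply: propext.
by subst V; congr Downset; exact: Prop_irrelevance.
Qed.

Theorem corollary1p2 (R : comPzRingType) (L : algebra R)
    (HL : noetherian_algebra L) :
  exists Phi : serre L -> downset (@Sim_le R L),
    (forall (C : serre L) (p : spec R) (c : sim (loc_ring p L)),
        Phi C (existT _ p c) <-> exists2 S, c S & loc_class C S) /\
    poset_isomorphism (@serre_le L) (@downset_le (Sim_R L) (@Sim_le R L)) Phi.
Proof.
pose Phi C := Downset (@simples_down R L C); exists Phi; split=> //.
pose Psi (W : downset (@Sim_le R L)) := Serre (serre_of_predP (down_mem W)).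
have PsiK W : Phi (Psi W) = W.
  by apply: downset_eq => x; exact: simples_serre_of_pred.
have le C D : serre_le C D <-> downset_le (Phi C) (Phi D).
  split=> [CD x [S xS [X CX XS]]|]; last exact: simples_reflect.
  by exists S => //; exists X => //; exact: CD.
split=> //; exists Psi => [C|//].
(* By [PsiK], [C] and [Psi (Phi C)] have the same image under [Phi], and [le] gives both
   inclusions. *)
by apply: serre_ext_eq => X; split; move: X; apply/le; rewrite PsiK.
Qed.
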